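(* Let $q$ be a power of a prime $p$ and let $O=\mathrm{Aut}(X_I)\,C_{F_J}$ be the $\mathrm{Aut}(X_I)$-orbit of the curve $C_{F_J}$. Let $V=X_I(\mathbb{F}_{q^2})$ and let $(V,E)$ be the graph in which two distinct vertices $v_1,v_2\in V$ are adjacent if and only if there is a curve $C\in O$ with $v_1,v_2\in C$. Then, for every $q$, $(V,E)$ is the complement graph of the point graph of the generalized quadrangle $\mathrm{GQ}(q^2,q)$ formed by the points $X_I(\mathbb{F}_{q^2})$ and the lines $\mathcal{L}(X_I)$. Its parameters as a strongly regular graph are $$(v,k,\lambda,\mu)=\left((q^3+1)(q^2+1),\; q^5,\; q(q-1)(q^3+q^2-1),\; q^3(q^2-1)\right).$$
   Context: Let $k$ be the algebraic closure of $\mathbb{F}_{q^2}$ (the symbol $k$ inside the parameter tuple instead denotes the valency of the graph). $X_I\subset\mathbb{P}^3(k)$ is the Fermat surface $x_0^{q+1}+x_1^{q+1}+x_2^{q+1}+x_3^{q+1}=0$; $\mathrm{Aut}(X_I)$ is its group of projective automorphisms, i.e. the elements of $\mathrm{PGL}_4(k)$ mapping $X_I$ to itself (isomorphic to $\mathrm{PGU}_4(\mathbb{F}_{q^2})$). $X_I(\mathbb{F}_{q^2})$ is the set of $\mathbb{F}_{q^2}$-rational points of $X_I$, and $\mathcal{L}(X_I)$ is the set of all lines of $\mathbb{P}^3(k)$ contained in $X_I$. Let $F_J$ be a $4\times4$ matrix with entries in $\mathbb{F}_{q^2}$ such that $${}^{\mathrm t}F_J\,F_J^{(q)}=\begin{pmatrix}0&0&0&-1\\0&1&0&0\\0&0&1&0\\-1&0&0&0\end{pmatrix},$$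 where $F_J^{(q)}$ is obtained from $F_J$ by raising every entry to the $q$-th power. $C_{F_J}$ is the rational curve of degree $q+1$ contained in $X_I$ given by the image of $$\mathbb{P}^1(k)\ni{}^{\mathrm t}(s,t)\mapsto F_J\,{}^{\mathrm t}(s^{q+1},\,s^qt,\,st^q,\,t^{q+1})\in\mathbb{P}^3(k).$$ The point graph of the generalized quadrangle has vertex set $X_I(\mathbb{F}_{q^2})$, two distinct points being adjacent if and only if they lie on a common line of $\mathcal{L}(X_I)$. Strongly regular parameters $(v,k,\lambda,\mu)$: $v$ vertices, regular of valency $k$, any two adjacent vertices have exactly $\lambda$ common neighbours, and any two distinct nonadjacent vertices have exactly $\mu$ common neighbours. *)

(* Defs.v *)
From HB Require Import structures.
From mathcomp Require Import all_boot all_order all_algebra.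
From mathcomp Require Import all_classical.

Set Implicit Arguments.
Unset Strict Implicit.
Unset Printing Implicit Defensive.

Import GRing.Theory.
Local Open Scope classical_set_scope.
Local Open Scope card_scope.
Local Open Scope ring_scope.

(** Graphs and incidence structures.  [A #= `I_n] says that the set [A] is
    finite with exactly [n] elements. *)

Record graph (T : Type) := Graph {
  vertices : set T;
  adjacent : T -> T -> Prop }.

Definition complement_graph (T : Type) (G : graph T) : graph T :=
  Graph (vertices G)
    (fun x y => [/\ vertices G x, vertices G y, x <> y & ~ adjacent G x y]).

Definition neighbours (T : Type) (G : graph T) (x : T) : set T :=
  [set y | vertices G y /\ adjacent G x y].

Definition strongly_regular (T : Type) (G : graph T) (v k l m : nat) : Prop :=
  [/\ vertices G #= `I_v,
      forall x, vertices G x -> neighbours G x #= `I_k,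
      forall x y, vertices G x -> vertices G y -> adjacent G x y ->
        neighbours G x `&` neighbours G y #= `I_l
    & forall x y, vertices G x -> vertices G y -> x <> y ->
        ~ adjacent G x y -> neighbours G x `&` neighbours G y #= `I_m].

(** The Payne-Thas axioms for a generalized quadrangle of order [(s, t)]:
    [s + 1] points on each line, [t + 1] lines through each point. *)
Definition generalized_quadrangle (T U : Type) (Pts : set T) (Lns : set U)
    (inc : T -> U -> Prop) (s t : nat) : Prop :=
  [/\ (0 < s)%N /\ (0 < t)%N,
      forall x, Pts x -> [set L | Lns L /\ inc x L] #= `I_t.+1,
      forall L, Lns L -> [set x | Pts x /\ inc x L] #= `I_s.+1,
      forall x y L M, Pts x -> Pts y -> Lns L -> Lns M ->
        inc x L -> inc y L -> inc x M -> inc y M -> x = y \/ L = M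
    & forall x L, Pts x -> Lns L -> ~ inc x L ->
        exists! yM : T * U,
          [/\ Pts yM.1, Lns yM.2, inc x yM.2, inc yM.1 yM.2 & inc yM.1 L]].

Definition point_graph (T U : Type) (Pts : set T) (Lns : set U)
    (inc : T -> U -> Prop) : graph T :=
  Graph Pts (fun x y => [/\ Pts x, Pts y, x <> y &
    exists L, [/\ Lns L, inc x L & inc y L]]).

(** [psubspace K n d] is the type of [d]-dimensional projective subspaces of
    [P^n(K)], i.e. of [(d+1)]-dimensional linear subspaces of [K^(n+1)]. *)
Definition psubspace (K : fieldType) (n d : nat) : Type :=
  {U : {vspace 'cV[K]_n.+1} | \dim U == d.+1}.

Notation ppoint K n := (psubspace K n 0).
Notation pline K n := (psubspace K n 1).

Definition on_line (K : fieldType) (n : nat) (P : ppoint K n) (L : pline K n)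
  : Prop := (val P <= val L)%VS.

(** Elements of [PGL_(n+1)(K)], viewed as transformations of [P^n(K)]. *)
Definition PGL (K : fieldType) (n : nat) : set (ppoint K n -> ppoint K n) :=
  [set f | exists2 A : 'M[K]_n.+1, A \in unitmx &
     forall P : ppoint K n, val (f P) = (linfun (mulmx A) @: val P)%VS].

Definition projective_aut (K : fieldType) (n : nat) (X : set (ppoint K n))
  : set (ppoint K n -> ppoint K n) :=
  [set f | PGL f /\ f @` X = X].

Definition aut_orbit (K : fieldType) (n : nat) (X C : set (ppoint K n))
  : set (set (ppoint K n)) :=
  [set D | exists2 f, projective_aut X f & D = f @` C].

Definition fermat_surface (K : fieldType) (q : nat) : set (ppoint K 3) :=
  [set P : ppoint K 3 | forall x : 'cV[K]_4, x \in val P ->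
     \sum_(i < 4) x i 0 ^+ q.+1 = 0].
Arguments fermat_surface : clear implicits.

Definition lines_in (K : fieldType) (n : nat) (X : set (ppoint K n))
  : set (pline K n) :=
  [set L | forall P, on_line P L -> X P].

Definition rational_points (F K : fieldType) (iota : {rmorphism F -> K})
    (n : nat) (X : set (ppoint K n)) : set (ppoint K n) :=
  [set P | X P /\ exists x : 'cV[F]_n.+1, val P = <[map_mx iota x]>%VS].

Definition matJ (R : nzRingType) : 'M[R]_4 :=
  \matrix_(i < 4, j < 4)
    nth 0 (nth [::] [:: [::   0; 0; 0; - 1 ];
                        [::   0; 1; 0;   0 ];
                        [::   0; 0; 1;   0 ];
                        [:: - 1; 0; 0;   0 ] ] i) j.

Definition curve_param (K : fieldType) (q : nat) (s t : K) : 'cV[K]_4 :=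
  \col_(i < 4)
    nth 0 [:: s ^+ q.+1; s ^+ q * t; s * t ^+ q; t ^+ q.+1] i.

Definition rational_curve (K : fieldType) (q : nat) (A : 'M[K]_4)
  : set (ppoint K 3) :=
  [set P | exists s t : K, (s, t) <> (0, 0) /\
     val P = <[A *m curve_param q s t]>%VS].

Definition curve_graph (T : Type) (V : set T) (O : set (set T)) : graph T :=
  Graph V (fun x y => [/\ V x, V y, x <> y & exists C, [/\ O C, C x & C y]]).

(* Main.v *)
Require Import Defs.
From HB Require Import structures.
From mathcomp Require Import all_boot all_order all_algebra finfield ring.
From mathcomp Require Import all_classical.

Set Implicit Arguments.
Unset Strict Implicit.
Unset Printing Implicit Defensive.

Import GRing.Theory.
Local Open Scope ring_scope.

(** Let [sigma] be the [q]-Frobenius of [K] and [h(x, y) = sum_i x_i sigma(y_i)],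
    so that the surface is [h(x, x) = 0].  Polarising, a line of the surface is a
    totally isotropic plane [U] of [K^4]; it equals its own orthogonal, hence is
    stable under [sigma^2] and spanned by vectors over [F].  This gives the
    quadrangle axioms by linear algebra, the counts being done in coordinates
    attached to a frame, that is, a matrix [B] over [F] whose Gram matrix is
    [matJ]: every isotropic rational point is [B e0] for some frame, and every
    non-orthogonal pair of such points is [(B e0, B e3)], the frames being moved
    by explicit Heisenberg matrices from the given one [FJ].

    The curve [C] contains [FJ e0] and [FJ e3], and [B FJ^-1] is unitary, so two
    non-orthogonal points lie on a curve of the orbit.  Conversely
    [h] of two points of [C] with parameters [(s, t)], [(s', t')] is
    [- (s t' - t s')^q (s t'^(q^2) - t s'^(q^2))], which does not vanish when the
    points are distinct and the second one is fixed by [sigma^2]; an automorphism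
    preserves lines of the surface, hence also the points fixed by [sigma^2],
    because these are the intersections of two lines. *)

(** * Counting over a finite field *)

(** [X^#|F| - X] is the product of the distinct factors [X - z] over [F], so each divisor is, up to
    a unit, a product of some of them and has as many roots as its degree. *)
Lemma card_root_dvdp_genPoly (F : finFieldType) (P : {poly F}) :
  P %| 'X^#|F| - 'X -> (#|[set z | root P z]|.+1 = size P)%N.
Proof.
rewrite finField_genPoly -big_enum => /dvdp_prod_XsubC [m eP].
rewrite (eqp_size eP) size_prod_XsubC; congr _.+1.
have /card_uniqP <- : uniq (mask m (enum F)) by rewrite mask_uniq ?enum_uniq.
by apply: eq_card => z; rewrite inE (eqp_root eP) root_prod_XsubC.
Qed.

Section FiniteField.
Variables (p e q : nat) (F : finFieldType).
Hypotheses (p_prime : prime p) (e_gt0 : (0 < e)%N) (q_def : q = (p ^ e)%N).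
Hypothesis cardF : #|F| = (q ^ 2)%N.

Lemma q_gt1 : (1 < q)%N.
Proof. by rewrite q_def -{1}(expn0 p) ltn_exp2l // prime_gt1. Qed.

Lemma pcharF : p \in [pchar F].
Proof. by apply: (@card_finPcharP F p (e * 2)) => //; rewrite cardF q_def expnM. Qed.

Lemma exprDq (R : comNzRingType) (x y : R) :
  p \in [pchar R] -> (x + y) ^+ q = x ^+ q + y ^+ q.
Proof.
move=> pR; apply: exprDn_pchar; rewrite q_def.
by rewrite pnatX pnatE // pR.
Qed.

Lemma exprNq (R : comNzRingType) (x : R) : p \in [pchar R] -> (- x) ^+ q = - x ^+ q.
Proof.
move=> pR; apply/eqP; rewrite -addr_eq0 -exprDq // addNr expr0n.
by rewrite eqn0Ngt (ltnW q_gt1).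
Qed.

Lemma expfqq (x : F) : x ^+ q ^+ q = x.
Proof. by rewrite -exprM mulnn -cardF expf_card. Qed.

(** With [P = X^q + X - c] and [c^q = c], additivity of the [q]-th power gives
    [P^q - P = X^(q^2) - X], so [P] splits over [F] with simple roots. *)
Lemma card_trace_fiber (c : F) :
  c ^+ q = c -> #|[set z : F | z + z ^+ q == c]| = q.
Proof.
move=> cq; pose P : {poly F} := 'X^q + ('X - c%:P).
have szP : size P = q.+1.
  by rewrite size_polyDl size_polyXn // size_XsubC ltnS q_gt1.
have dP : P %| 'X^#|F| - 'X.
  have -> : 'X^#|F| - 'X = P ^+ q - P.
    have pP : p \in [pchar {poly F}] by rewrite pchar_poly pcharF.
    rewrite /P !exprDq // exprNq // -rmorphXn /= cq -exprM cardF expnS expn1.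
    ring.
  by rewrite dvdp_sub // dvdp_exp // ltnW ?q_gt1.
apply/eq_add_S; rewrite -szP -card_root_dvdp_genPoly //; congr _.+1.
by apply: eq_card => z; rewrite !inE rootE !hornerE subr_eq0 addrC.
Qed.

(** Since [c^(q-1) = 1], [X^(q^2) - X] equals [X] times the difference of the [(q-1)]-th powers of
    [X^(q+1)] and [c], hence is divisible by [X^(q+1) - c]. *)
Lemma card_norm_fiber (c : F) :
  c != 0 -> c ^+ q = c -> #|[set z : F | z ^+ q.+1 == c]| = q.+1.
Proof.
move=> c0 cq; pose P : {poly F} := 'X^(q.+1) - c%:P.
have szP : size P = q.+2 by rewrite size_XnsubC.
have cq1 : c ^+ q.-1 = 1.
  by apply: (mulfI c0); rewrite -exprS (prednK (ltnW q_gt1)) cq mulr1.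
have dP : P %| 'X^#|F| - 'X.
  have -> : 'X^#|F| - 'X = 'X * ('X^(q.+1) ^+ q.-1 - c%:P ^+ q.-1) :> {poly F}.
    rewrite -rmorphXn /= cq1 mulrBr mulr1 -exprM -exprS cardF; congr ('X^_ - _).
    by case: q q_gt1 => // n _; rewrite /= expnS expn1; ring.
  by rewrite subrXX dvdp_mull // dvdp_mulr.
apply/eq_add_S; rewrite -szP -card_root_dvdp_genPoly //; congr _.+1.
by apply: eq_card => z; rewrite !inE rootE !hornerE subr_eq0.
Qed.

Lemma exprN1q : (-1) ^+ q = -1 :> F.
Proof. by rewrite exprNq ?pcharF // expr1n. Qed.

Lemma norm_fixed (x : F) : (x ^+ q.+1) ^+ q = x ^+ q.+1.
Proof. by rewrite -exprM mulSn exprD exprM expfqq -exprSr. Qed.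

Lemma card_prod_sum (A B : finType) (P : A -> B -> bool) :
  #|[set t : A * B | P t.1 t.2]| = (\sum_(b : B) #|[set a | P a b]|)%N.
Proof.
rewrite -sum1_card.
under [RHS]eq_bigr => b _ do rewrite -sum1_card.
rewrite (exchange_big_dep xpredT) //= pair_big_dep /=.
by apply: eq_bigl => t; rewrite !inE.
Qed.

(** The triples [(a, (b, c))] for which [(a, b, c, 1)], read in the coordinates of a frame, is
    isotropic. *)
Definition affine_pts : {set F * (F * F)} :=
  [set t | t.1 + t.1 ^+ q == t.2.1 ^+ q.+1 + t.2.2 ^+ q.+1].

Lemma card_affine_fiber (d : F * F) :
  #|[set a : F | a + a ^+ q == d.1 ^+ q.+1 + d.2 ^+ q.+1]| = q.
Proof. by apply: card_trace_fiber; rewrite exprDq ?pcharF // !norm_fixed. Qed.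

Lemma card_affine_pts : #|affine_pts| = (q ^ 5)%N.
Proof.
rewrite (card_prod_sum (fun a d => a + a ^+ q == d.1 ^+ q.+1 + d.2 ^+ q.+1)).
under eq_bigr do rewrite card_affine_fiber.
by rewrite sum_nat_const card_prod cardF; ring.
Qed.

(** The second coordinate [0] forces the first to be [0]; each of the [q^2 - 1] other values [b]
    leaves a norm fibre over [- b^(q+1)], of size [q + 1]. *)
Lemma card_isotropic_plane :
  #|[set d : F * F | d.1 ^+ q.+1 + d.2 ^+ q.+1 == 0]| = (1 + (q ^ 2 - 1) * q.+1)%N.
Proof.
rewrite (card_prod_sum (fun a b => a ^+ q.+1 + b ^+ q.+1 == 0)) (bigD1 0) //=.
congr addn.
  rewrite -(cards1 (0 : F)); apply: eq_card => a.
  by rewrite !inE expr0n addr0 expf_eq0.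
rewrite (eq_bigr (fun=> q.+1)) => [|b b0].
  by rewrite sum_nat_const cardC1 cardF subn1.
rewrite -[RHS](@card_norm_fiber (- b ^+ q.+1)) ?oppr_eq0 ?expf_neq0 //.
  by apply: eq_card => a; rewrite !inE addr_eq0.
by rewrite exprNq ?pcharF // norm_fixed.
Qed.

(** The complement [a = 0] is the isotropic plane just counted. This is the source of the parameter
    [lambda]: in a frame, [a = 0] is orthogonality to the last basis vector. *)
Lemma card_affine_pts_neq0 :
  #|[set t in affine_pts | t.1 != 0]| = (q * (q - 1) * (q ^ 3 + q ^ 2 - 1))%N.
Proof.
have := cardsID [set t : F * (F * F) | t.1 == 0] affine_pts.
rewrite card_affine_pts.
have -> : #|affine_pts :&: [set t | t.1 == 0]|
    = #|[set d : F * F | d.1 ^+ q.+1 + d.2 ^+ q.+1 == 0]|.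
  rewrite -[RHS](@card_imset _ _ (pair (0 : F))) => [|? ? [->]//].
  apply: eq_card => -[a d]; rewrite !inE; apply/idP/imsetP => /=.
    case/andP=> /[swap] /eqP->; rewrite expr0n add0r gtn_eqF ?(ltnW q_gt1) //=.
    by rewrite eq_sym => dP; exists d; rewrite ?inE.
  case=> d' /[!inE] /eqP dP [-> ->].
  by rewrite expr0n add0r gtn_eqF ?(ltnW q_gt1) // dP !eqxx.
have -> : affine_pts :\: [set t | t.1 == 0] = [set t in affine_pts | t.1 != 0].
  by apply/setP => t; rewrite !inE andbC.
rewrite card_isotropic_plane => cardE; apply: (addnI (etrans cardE _)).
(* Writing [q = n + 1] removes the truncated subtractions, which [ring] cannot treat. *)
case: (q) q_gt1 => // n _.
rewrite (_ : n.+1 ^ 2 = (n * n.+2).+1)%N; last by ring.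
rewrite addnS !subn1 /=; ring.
Qed.

(** As [r != 0], the excluded affine line is a graph over the second coordinate and has [q^2]
    points; each of the [q^4 - q^2] remaining pairs admits [q] values of [a]. This is the source of
    the parameter [mu]. *)
Lemma card_affine_pts_off_line (r s t : F) : r != 0 ->
  #|[set u in affine_pts | r * u.2.1 + s * u.2.2 + t != 0]|
    = (q ^ 3 * (q ^ 2 - 1))%N.
Proof.
move=> r0; rewrite (eq_card (B := [set u : F * (F * F) |
  (u.1 + u.1 ^+ q == u.2.1 ^+ q.+1 + u.2.2 ^+ q.+1)
    && (r * u.2.1 + s * u.2.2 + t != 0)])); last by move=> u; rewrite !inE.
rewrite (card_prod_sum (fun a d => (a + a ^+ q == d.1 ^+ q.+1 + d.2 ^+ q.+1)
    && (r * d.1 + s * d.2 + t != 0))).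
rewrite (bigID (fun d => r * d.1 + s * d.2 + t != 0)) /= [X in (_ + X)%N]big1.
  rewrite addn0 (eq_bigr (fun=> q)) => [|d dP]; last first.
    rewrite -[RHS](card_affine_fiber d).
    by apply: eq_card => a; rewrite !inE dP andbT.
  rewrite sum_nat_const.
  have -> : #|[pred d : F * F | r * d.1 + s * d.2 + t != 0]| = (q ^ 4 - q ^ 2)%N.
    have := cardC [pred d : F * F | r * d.1 + s * d.2 + t == 0].
    rewrite card_prod cardF -expnD => <-.
    have -> : #|[pred d : F * F | r * d.1 + s * d.2 + t == 0]| = (q ^ 2)%N.
      rewrite -cardF -[RHS](@card_imset _ _ (fun b : F => (- (s * b + t) / r, b))).
        apply: eq_card => -[a b]; rewrite inE /=; apply/idP/imsetP => /=.
          move=> /eqP dP; exists b => //; congr pair; apply: (mulfI r0).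
          by rewrite [RHS]mulrC mulfVK //; apply/eqP; rewrite -addr_eq0 addrA dP.
        by case=> b' _ [-> ->]; apply/eqP; field.
      by move=> ? ? [].
    by rewrite addKn; apply: eq_card => d; rewrite !inE.
  by rewrite mulnBl mulnBr muln1 -expnD -!expnSr.
by move=> d /negPn dP; apply: eq_card0 => a; rewrite !inE dP andbF.
Qed.

End FiniteField.

(** * Lines and the Hermitian form *)

Section Lines.
Variables (K : fieldType) (n : nat).
Implicit Types (x y z v w : 'cV[K]_n) (U : {vspace 'cV[K]_n}).

Lemma mem_span2P v w z :
  reflect (exists a b, z = a *: v + b *: w) (z \in <[v]> + <[w]>)%VS.
Proof.
apply: (iffP memv_addP) => [[_ /vlineP[a ->] [_ /vlineP[b ->] ->]]|[a [b ->]]].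
  by exists a, b.
by exists (a *: v); rewrite ?memvZ ?memv_line //; exists (b *: w);
   rewrite ?memvZ ?memv_line.
Qed.

Lemma memv_span2l v w : v \in (<[v]> + <[w]>)%VS.
Proof. by rewrite memvE addvSl. Qed.

Lemma memv_span2r v w : w \in (<[v]> + <[w]>)%VS.
Proof. by rewrite memvE addvSr. Qed.

Lemma dim_span2 v w : v != 0 -> w \notin <[v]>%VS -> \dim (<[v]> + <[w]>) = 2.
Proof.
move=> v0 wv; have /eqnP : free [:: w; v].
  by rewrite free_cons span_seq1 wv seq1_free.
by rewrite span_cons span_seq1 addvC.
Qed.

Lemma dim2_span2 U v w : \dim U = 2 -> v \in U -> w \in U -> v != 0 ->
  w \notin <[v]>%VS -> U = (<[v]> + <[w]>)%VS.
Proof.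
move=> dU vU wU v0 wv; apply/esym/eqP.
by rewrite eqEdim dU dim_span2 // subv_add -!memvE vU wU.
Qed.

(* Being a reduced echelon basis, [v, w] is fixed by every field automorphism
   that stabilises [U]; this is how rationality descends to it. *)
Lemma dim2_echelon U : \dim U = 2 -> exists i j v w,
  [/\ v i 0 = 1 /\ v j 0 = 0, w i 0 = 0 /\ w j 0 = 1, v \in U, w \in U &
      forall z, z \in U -> z = z i 0 *: v + z j 0 *: w].
Proof.
move=> dU; have U0 : U != 0%VS by rewrite -dimv_eq0 dU.
have v0 : vpick U != 0 by rewrite vpick0.
have [i vi] := cV0Pn _ v0.
pose v1 := (vpick U i 0)^-1 *: vpick U.
have v1U : v1 \in U by rewrite memvZ ?memv_pick.
have v1i : v1 i 0 = 1 by rewrite mxE mulVf.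
have : ~~ (U <= <[v1]>)%VS.
  by apply/negP => /dimvS; rewrite dU dim_vline; case: (_ != _).
case/subvPn => w0 w0U w0v.
pose w1 := w0 - w0 i 0 *: v1.
have w1U : w1 \in U by apply: memvB => //; apply: memvZ.
have w1i : w1 i 0 = 0 by rewrite !mxE mulVf // mulr1 subrr.
have w10 : w1 != 0.
  by apply: contraNneq w0v => /eqP; rewrite subr_eq0 => /eqP ->; rewrite memvZ ?memv_line.
have [j wj] := cV0Pn _ w10.
pose w := (w1 j 0)^-1 *: w1; pose v := v1 - v1 j 0 *: w.
have wU : w \in U by rewrite memvZ.
have vU : v \in U by apply: memvB => //; apply: memvZ.
have wi : w i 0 = 0 by rewrite mxE w1i mulr0.
have wj1 : w j 0 = 1 by rewrite mxE mulVf.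
have vi1 : v i 0 = 1 by rewrite mxE v1i mxE [(_ *: w) i 0]mxE wi mulr0 subr0.
have vj : v j 0 = 0 by rewrite mxE [in X in _ + X]mxE [(_ *: w) j 0]mxE wj1 mulr1 subrr.
clearbody v w; exists i, j, v, w; split; [by split|by split|by []|by []|move=> z].
have v_neq0 : v != 0.
  by apply/eqP => /matrixP/(_ i 0); rewrite vi1 mxE => /eqP; rewrite oner_eq0.
have wv : w \notin <[v]>%VS.
  apply/vlineP => -[k] /matrixP/(_ j 0); rewrite wj1 mxE vj mulr0.
  by move/eqP; rewrite oner_eq0.
rewrite (dim2_span2 dU vU wU v_neq0 wv) => /mem_span2P[a [b ->]].
by rewrite !mxE vi1 wi vj wj1 !mulr0 !mulr1 addr0 add0r.
Qed.

End Lines.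

(** * The sesquilinear form, rationality and isotropic subspaces *)

Section Form.
Variables (K : fieldType) (sigma : {rmorphism K -> K}) (n : nat).
Implicit Types (x y z : 'cV[K]_n) (a : K).

Definition hform x y : K := (x^T *m map_mx sigma y) 0 0.

Definition frob2 m k (A : 'M[K]_(m, k)) := map_mx sigma (map_mx sigma A).

(** Once [sigma] is the [q]-Frobenius, these are the matrices with entries in [F]; the fixed-point
    formulation keeps the linear algebra inside [K]. *)
Definition rational m k (A : 'M[K]_(m, k)) := frob2 A = A.

Lemma hformE x y : hform x y = \sum_i x i 0 * sigma (y i 0).
Proof. by rewrite /hform mxE; apply: eq_bigr => i _; rewrite !mxE. Qed.

Lemma hformDl x y z : hform (x + y) z = hform x z + hform y z.
Proof. by rewrite /hform linearD mulmxDl mxE. Qed.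

Lemma hformZl a x z : hform (a *: x) z = a * hform x z.
Proof. by rewrite /hform linearZ -scalemxAl mxE. Qed.

Lemma hformDr x y z : hform x (y + z) = hform x y + hform x z.
Proof. by rewrite /hform map_mxD mulmxDr mxE. Qed.

Lemma hformZr a x y : hform x (a *: y) = sigma a * hform x y.
Proof. by rewrite /hform map_mxZ -scalemxAr mxE. Qed.

Lemma hform0l x : hform 0 x = 0.
Proof. by rewrite /hform trmx0 mul0mx mxE. Qed.

(** On [K] the map [sigma] need not be an involution, so the form is Hermitian only up to this twist
    by [frob2]. *)
Lemma hform_conj x y : sigma (hform x y) = hform (frob2 y) x.
Proof.
rewrite !hformE rmorph_sum; apply: eq_bigr => i _.
by rewrite rmorphM !mxE mulrC.
Qed.

Lemma hform_conj_rational x y : rational y -> sigma (hform x y) = hform y x.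
Proof. by move=> yr; rewrite hform_conj yr. Qed.

Lemma hform_sym0 x y : rational y -> hform x y = 0 -> hform y x = 0.
Proof. by move=> /hform_conj_rational <- ->; rewrite rmorph0. Qed.

Lemma rationalD m k (A B : 'M[K]_(m, k)) :
  rational A -> rational B -> rational (A + B).
Proof. by rewrite /rational /frob2 !map_mxD => -> ->. Qed.

Lemma rationalZ m k a (A : 'M[K]_(m, k)) :
  sigma (sigma a) = a -> rational A -> rational (a *: A).
Proof. by rewrite /rational /frob2 !map_mxZ => -> ->. Qed.

Lemma rationalM m k l (A : 'M[K]_(m, k)) (B : 'M[K]_(k, l)) :
  rational A -> rational B -> rational (A *m B).
Proof. by rewrite /rational /frob2 !map_mxM => -> ->. Qed.

Lemma rationalV (A : 'M[K]_n) : rational A -> rational (invmx A).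
Proof. by rewrite /rational /frob2 !map_invmx => ->. Qed.

Lemma rationalE m k (A : 'M[K]_(m, k)) :
  rational A <-> forall i j, sigma (sigma (A i j)) = A i j.
Proof.
split=> [Ar i j|Ar]; first by move/matrixP: Ar => /(_ i j); rewrite !mxE.
by apply/matrixP => i j; rewrite !mxE.
Qed.

Lemma hform_rational x y : rational x -> rational y ->
  sigma (sigma (hform x y)) = hform x y.
Proof. by move=> xr yr; rewrite !hform_conj_rational. Qed.

Definition isotropic (U : {vspace 'cV[K]_n}) :=
  forall x y, x \in U -> y \in U -> hform x y = 0.

Lemma isotropic_span2 x y : hform x x = 0 -> hform y y = 0 ->
  hform x y = 0 -> hform y x = 0 -> isotropic (<[x]> + <[y]>)%VS.
Proof.
move=> xx yy xy yx _ _ /mem_span2P[a [b ->]] /mem_span2P[c [d ->]].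
rewrite !(hformDl, hformDr, hformZl, hformZr) xx yy xy yx.
by rewrite !(mulr0, addr0).
Qed.

(* Polarisation; the scalar [t] separates [hform x y] from [hform y x]. *)
Lemma isotropic_quadric (t : K) (U : {vspace 'cV[K]_n}) : sigma t != t ->
  (forall x, x \in U -> hform x x = 0) -> isotropic U.
Proof.
move=> tP UP x y xU yU.
have polar a : sigma a * hform x y + a * hform y x = 0.
  have /UP : x + a *: y \in U by apply: memvD => //; apply: memvZ.
  rewrite !(hformDl, hformDr, hformZl, hformZr) !UP // !mulr0 addr0 add0r.
  by rewrite mulrC.
have := polar 1; rewrite rmorph1 !mul1r => /eqP; rewrite addr_eq0 => /eqP xy.
have := polar t; rewrite xy mulrN addrC -mulrBl => /eqP.
rewrite mulf_eq0 subr_eq0 eq_sym (negPf tP) => /eqP ->.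
by rewrite oppr0.
Qed.

End Form.

Section Dim4.
Variables (K : fieldType) (sigma : {rmorphism K -> K}).
Notation hform := (hform sigma).
Notation rational := (rational sigma).
Notation isotropic := (isotropic sigma).
Implicit Types (x y z : 'cV[K]_4) (U : {vspace 'cV[K]_4}).

(** The orthogonal of [U] is the kernel of the transposed conjugate of a basis matrix [M], of rank
    [4 - 2 = 2]. It contains the rows of [M] by isotropy, hence is no larger than [U]. *)
Lemma isotropic_perp U x : \dim U = 2 -> isotropic U ->
  (forall y, y \in U -> hform x y = 0) -> x \in U.
Proof.
move=> dU iU xU.
have [i [j [v [w [[vi vj] [wi wj] vU wU _]]]]] := dim2_echelon dU.
pose M := col_mx v^T w^T : 'M[K]_(1 + 1, 4).
have freeM : row_free M.
  (* Extracting the pivot columns [i] and [j] of the echelon basis inverts [M] on the right. *)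
  apply/row_freeP; exists (row_mx (delta_mx i 0) (delta_mx j 0)).
  rewrite mul_col_row -!colE scalar_mx_block.
  by congr block_mx; apply/matrixP => k l; rewrite !mxE !ord1 /= ?vi ?vj ?wi ?wj.
have kM y : (forall z, z \in U -> hform y z = 0) -> 
   (y^T <= kermx (map_mx sigma M)^T)%MS.
  move=> yU; apply/sub_kermxP.
  rewrite map_col_mx tr_col_mx mul_mx_row.
  have yr z : z \in U -> y^T *m (map_mx sigma z^T)^T = 0.
    move=> /yU yz; apply/matrixP => k l; rewrite !ord1 -map_trmx trmxK.
    by rewrite [LHS]yz mxE.
  by rewrite !yr // row_mx0.
have sM : (M <= kermx (map_mx sigma M)^T)%MS.
  by rewrite col_mx_sub !kM // => z zU; apply: iU.
have := mxrank_leqif_sup sM.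
rewrite mxrank_ker mxrank_tr mxrank_map (eqnP freeM).
move/geq_leqif; rewrite leqnn => /esym kM'.
have /submxP[D] : (x^T <= M)%MS := submx_trans (kM x xU) kM'.
rewrite -[D]hsubmxK mul_row_col [lsubmx D]mx11_scalar [rsubmx D]mx11_scalar.
rewrite !mul_scalar_mx -!linearZ -linearD => /trmx_inj ->.
by apply: memvD; apply: memvZ.
Qed.

End Dim4.

(** * Frames *)

Section Frames.
Variables (K : fieldType) (sigma : {rmorphism K -> K}).
Notation hform := (hform sigma).
Notation rational := (rational sigma).

Definition col4 (a b c d : K) : 'cV[K]_4 := \col_(i < 4) nth 0 [:: a; b; c; d] i.

Lemma col4P (u : 'cV[K]_4) : exists a b c d, u = col4 a b c d.
Proof.
exists (u 0 0), (u 1 0), (u 2%:R 0), (u 3%:R 0).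
apply/matrixP => i j; rewrite ord1 mxE.
by case: i => [[|[|[|[|//]]]] ?] /=; congr (u _ 0); apply: val_inj.
Qed.

Lemma col4_inj a b c d a' b' c' d' : col4 a b c d = col4 a' b' c' d' ->
  [/\ a = a', b = b', c = c' & d = d'].
Proof.
move=> /matrixP e; have := (e 0 0, e 1 0, e 2%:R 0, e 3%:R 0).
by rewrite !mxE /= => -[[[-> ->] ->] ->].
Qed.

Lemma col4Z k a b c d : k *: col4 a b c d = col4 (k * a) (k * b) (k * c) (k * d).
Proof.
by apply/matrixP => i j; rewrite !mxE; case: i => [[|[|[|[|//]]]] ?].
Qed.

Lemma col4D a b c d a' b' c' d' : col4 a b c d + col4 a' b' c' d'
  = col4 (a + a') (b + b') (c + c') (d + d').
Proof.
by apply/matrixP => i j; rewrite !mxE; case: i => [[|[|[|[|//]]]] ?].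
Qed.

Lemma col4_eq0 : col4 0 0 0 0 = 0.
Proof.
by apply/matrixP => i j; rewrite !mxE; case: i => [[|[|[|[|//]]]] ?].
Qed.

Lemma map_col4 (f : {rmorphism K -> K}) a b c d :
  map_mx f (col4 a b c d) = col4 (f a) (f b) (f c) (f d).
Proof.
by apply/matrixP => i j; rewrite !mxE; case: i => [[|[|[|[|//]]]] ?].
Qed.

Lemma rational_col4 a b c d : rational (col4 a b c d) <->
  [/\ sigma (sigma a) = a, sigma (sigma b) = b, sigma (sigma c) = c
    & sigma (sigma d) = d].
Proof.
rewrite /rational /frob2 !map_col4; split=> [/col4_inj //|].
by case=> -> -> -> ->.
Qed.

Definition mat4 (r : seq (seq K)) : 'M[K]_4 :=
  \matrix_(i < 4, j < 4) nth 0 (nth [::] r i) j.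

(** The unipotent matrix fixing the first basis vector and sending the last one to [(a, b, c, 1)];
    its first row is what unitarity for [matJ] then dictates. *)
Definition heisenberg (a b c : K) : 'M[K]_4 :=
  mat4 [:: [:: 1; sigma b; sigma c; a];
           [:: 0; 1; 0; b];
           [:: 0; 0; 1; c];
           [:: 0; 0; 0; 1]].

(** The unitary permutation exchanging the two isotropic basis vectors. *)
Definition swap03 : 'M[K]_4 :=
  mat4 [:: [:: 0; 0; 0; 1];
           [:: 0; 1; 0; 0];
           [:: 0; 0; 1; 0];
           [:: 1; 0; 0; 0]].

Lemma heisenberg_col4 a b c x y z t : heisenberg a b c *m col4 x y z t
  = col4 (x + sigma b * y + sigma c * z + a * t) (y + b * t) (z + c * t) t.
Proof.
apply/matrixP => i j; rewrite !mxE !big_ord_recl big_ord0 !mxE.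
by case: i => [[|[|[|[|//]]]] ?] /=; rewrite ?ltnS ?ltn0 /=; ring.
Qed.

Lemma swap03_col4 x y z t : swap03 *m col4 x y z t = col4 t y z x.
Proof.
apply/matrixP => i j; rewrite !mxE !big_ord_recl big_ord0 !mxE.
by case: i => [[|[|[|[|//]]]] ?] /=; ring.
Qed.

Lemma matJ_col4 x y z t : matJ K *m col4 x y z t = col4 (- t) y z (- x).
Proof.
apply/matrixP => i j; rewrite !mxE !big_ord_recl big_ord0 !mxE.
by case: i => [[|[|[|[|//]]]] ?] /=; ring.
Qed.

Lemma mulmx_col4_inj (A B : 'M[K]_4) :
  (forall a b c d, A *m col4 a b c d = B *m col4 a b c d) -> A = B.
Proof.
move=> AB; apply/matrixP => i j.
have [a [b [c [d e]]]] := col4P (delta_mx j 0).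
have := AB a b c d; rewrite -e -!colE => /matrixP/(_ i 0).
by rewrite !mxE.
Qed.

Lemma matJ_sq : matJ K *m matJ K = 1%:M.
Proof.
apply: mulmx_col4_inj => a b c d.
by rewrite mul1mx -mulmxA !matJ_col4 !opprK.
Qed.

Lemma dot_col4 x y z t x' y' z' t' :
  ((col4 x y z t)^T *m col4 x' y' z' t') 0 0 = x * x' + y * y' + z * z' + t * t'.
Proof. by rewrite !mxE !big_ord_recl big_ord0 !mxE /=; ring. Qed.

Definition frame (B : 'M[K]_4) := rational B /\ B^T *m map_mx sigma B = matJ K.

Lemma frame_unit B : frame B -> B \in unitmx.
Proof.
case=> _ BJ; rewrite -unitmx_tr.
have : B^T *m (map_mx sigma B *m matJ K) = 1%:M by rewrite mulmxA BJ matJ_sq.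
by case/mulmx1_unit.
Qed.

Lemma hform_frame B x y z t x' y' z' t' : frame B ->
  hform (B *m col4 x y z t) (B *m col4 x' y' z' t')
  = y * sigma y' + z * sigma z' - x * sigma t' - t * sigma x'.
Proof.
case=> _ BJ; rewrite /hform trmx_mul map_mxM mulmxA -[_ *m map_mx _ B]mulmxA BJ.
by rewrite map_col4 -mulmxA matJ_col4 dot_col4; ring.
Qed.

Lemma frameM B H : frame B -> rational H ->
  H^T *m matJ K *m map_mx sigma H = matJ K -> frame (B *m H).
Proof.
move=> [Br BJ] Hr HJ; split; first exact: rationalM.
by rewrite trmx_mul map_mxM mulmxA -[_ *m map_mx _ B]mulmxA BJ.
Qed.

Lemma frame_swap B : frame B -> frame (B *m swap03).
Proof.
move=> Bf; apply: frameM => //.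
  by apply/rationalE => i j; rewrite mxE;
    case: i => [[|[|[|[|//]]]] ?]; case: j => [[|[|[|[|//]]]] ?] /=;
    rewrite ?rmorph0 ?rmorph1 ?rmorph0 ?rmorph1.
have -> : swap03^T = swap03.
  by apply/matrixP => i j; rewrite !mxE;
    case: i => [[|[|[|[|//]]]] ?]; case: j => [[|[|[|[|//]]]] ?].
have -> : map_mx sigma swap03 = swap03.
  by apply/matrixP => i j; rewrite !mxE;
    case: i => [[|[|[|[|//]]]] ?]; case: j => [[|[|[|[|//]]]] ?] /=;
    rewrite ?rmorph0 ?rmorph1.
apply: mulmx_col4_inj => a b c d.
by rewrite -!mulmxA swap03_col4 !matJ_col4 swap03_col4.
Qed.

Lemma frame_heisenberg B a b c : frame B ->
  sigma (sigma a) = a -> sigma (sigma b) = b -> sigma (sigma c) = c ->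
  a + sigma a = b * sigma b + c * sigma c -> frame (B *m heisenberg a b c).
Proof.
move=> Bf ar br cr abc; apply: frameM => //.
  by apply/rationalE => i j; rewrite mxE;
    case: i => [[|[|[|[|//]]]] ?]; case: j => [[|[|[|[|//]]]] ?] /=;
    rewrite ?rmorph0 ?rmorph1 ?rmorph0 ?rmorph1 ?br ?cr ?ar.
have sa : sigma a = b * sigma b + c * sigma c - a by rewrite -abc addrAC subrr add0r.
apply/matrixP => i j; rewrite !(mxE, big_ord_recl, big_ord0).
case: i => [[|[|[|[|//]]]] ?]; case: j => [[|[|[|[|//]]]] ?] /=;
  rewrite ?rmorph0 ?rmorph1 ?br ?cr; try ring.
(* Only the Gram entry of the last column with itself uses the relation between [a], [b] and [c]. *)
by rewrite sa; ring.
Qed.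

End Frames.

Lemma vlineZ (K : fieldType) (vT : vectType K) (k : K) (x : vT) :
  k != 0 -> <[k *: x]>%VS = <[x]>%VS.
Proof.
move=> k0; apply/eqP; rewrite eqEsubv -!memvE memvZ ?memv_line //=.
by rewrite -{1}(scalerK k0 x) memvZ ?memv_line.
Qed.

(** * Rationality of isotropic planes, and frames through given isotropic vectors *)

Section IsotropicLines.
Variables (K : fieldType) (sigma : {rmorphism K -> K}).
Notation hform := (hform sigma).
Notation rational := (rational sigma).
Notation isotropic := (isotropic sigma).
Notation frame := (frame sigma).
Implicit Types (x y z : 'cV[K]_4) (U : {vspace 'cV[K]_4}).

Lemma norm_quotient (b c : K) : b != 0 -> b * sigma b + c * sigma c = 0 ->
  c / b * sigma (c / b) = -1.
Proof.
move=> b0 bc; have sb0 : sigma b != 0 by rewrite fmorph_eq0.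
rewrite rmorphM fmorphV; apply: (mulfI (mulf_neq0 b0 sb0)).
rewrite mulrN1; apply/eqP; rewrite -addr_eq0 addrC; apply/eqP.
by rewrite -[RHS]bc; field; rewrite b0 sb0.
Qed.

(** By [hform_conj], [frob2 sigma x] is orthogonal to [U], and [U] is its own orthogonal. *)
Lemma isotropic_frob2 U x : \dim U = 2 -> isotropic U -> x \in U ->
  frob2 sigma x \in U.
Proof.
move=> dU iU xU; apply: (isotropic_perp dU iU) => y yU.
by rewrite -hform_conj iU // rmorph0.
Qed.

(** The pivot entries [0] and [1] are fixed by [sigma], so [frob2 sigma v], which lies in [U], has
    the same coordinates as [v]; likewise for [w]. *)
Lemma isotropic_echelon U : \dim U = 2 -> isotropic U ->
  exists (i j : 'I_4) (v w : 'cV[K]_4),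
  [/\ [/\ v i 0 = 1, v j 0 = 0, w i 0 = 0 & w j 0 = 1],
      rational v /\ rational w, v \in U, w \in U &
      forall z, z \in U -> z = z i 0 *: v + z j 0 *: w].
Proof.
move=> dU iU.
have [i [j [v [w [[vi vj] [wi wj] vU wU zE]]]]] := dim2_echelon dU.
exists i, j, v, w; split=> //; split; rewrite /rational.
  have /zE -> := isotropic_frob2 dU iU vU.
  by rewrite !mxE vi vj !(rmorph0, rmorph1) scale1r scale0r addr0.
have /zE -> := isotropic_frob2 dU iU wU.
by rewrite !mxE wi wj !(rmorph0, rmorph1) scale1r scale0r add0r.
Qed.

Lemma frame_rational B (u : 'cV[K]_4) : frame B -> rational (B *m u) <-> rational u.
Proof.
move=> Bf; have [Br _] := Bf; split; last exact: rationalM.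
by move/(rationalM (rationalV Br)); rewrite mulKmx // (frame_unit Bf).
Qed.

Lemma frame_coords B x : frame B -> exists a b c d, x = B *m col4 a b c d.
Proof.
move=> /frame_unit Bu; have [a [b [c [d e]]]] := col4P (invmx B *m x).
by exists a, b, c, d; rewrite -e mulKVmx.
Qed.

Lemma frame_inj B (u v : 'cV[K]_4) : frame B -> B *m u = B *m v -> u = v.
Proof. by move=> /frame_unit Bu /(congr1 (mulmx (invmx B))); rewrite !mulKmx. Qed.

Lemma frame_col_neq0 B a b c d : frame B -> [|| a != 0, b != 0, c != 0 | d != 0] ->
  B *m col4 a b c d != 0.
Proof.
move=> Bf; apply: contraTneq; rewrite -(mulmx0 _ B) => /(frame_inj Bf).
by rewrite -col4_eq0 => /col4_inj[-> -> -> ->]; rewrite eqxx.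
Qed.

Lemma frame_e0_neq0 B : frame B -> B *m col4 1 0 0 0 != 0.
Proof. by move=> Bf; apply: frame_col_neq0; rewrite ?oner_neq0. Qed.

(** If [y] has frame coordinates [(a, b, c, d)], its product with the first basis vector is
    [- sigma d], so [d != 0]. The Heisenberg matrix with last column [y / d] is the required move,
    and isotropy of [y] is exactly its unitarity condition. *)
Lemma frame_hyperbolic B y : frame B -> rational y -> hform y y = 0 ->
  hform (B *m col4 1 0 0 0) y != 0 ->
  exists B' k, [/\ frame B', k != 0,
    B' *m col4 1 0 0 0 = B *m col4 1 0 0 0 & B' *m col4 0 0 0 1 = k *: y].
Proof.
move=> Bf yr yy; have [a [b [c [d yE]]]] := frame_coords y Bf.
move: yr yy; rewrite {y}yE frame_rational // => /rational_col4[ar br cr dr].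
rewrite !hform_frame // => yy.
rewrite !mul0r mul1r !(add0r, subr0) oppr_eq0 => sd0.
have d0 : d != 0 by apply: contraNneq sd0 => ->; rewrite rmorph0.
exists (B *m heisenberg sigma (a / d) (b / d) (c / d)), d^-1; split.
- apply: frame_heisenberg; rewrite // !rmorphM ?ar ?br ?cr !fmorphV ?dr //.
  apply/eqP; rewrite -subr_eq0; apply/eqP.
  transitivity (- (b * sigma b + c * sigma c - a * sigma d - d * sigma a)
     / (d * sigma d)); first by field; rewrite d0 sd0.
  by rewrite yy oppr0 mul0r.
- by rewrite invr_eq0.
- by rewrite -mulmxA heisenberg_col4 !(mulr0, addr0).
- rewrite -mulmxA heisenberg_col4 scalemxAr col4Z !(mulr0, mulr1, add0r).
  by rewrite mulVf // ![d^-1 * _]mulrC.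
Qed.

(** It suffices to find a frame whose first or last basis vector is not orthogonal to [x]:
    [frame_hyperbolic] then puts a multiple of [x] last, and a swap brings it first. *)
Lemma frame_isotropic B x (t : K) : frame B -> sigma (sigma t) = t ->
  t + sigma t = 1 -> x != 0 -> rational x -> hform x x = 0 ->
  exists B' k, [/\ frame B', k != 0 & B' *m col4 1 0 0 0 = k *: x].
Proof.
move=> Bf tr tt x0 xr xx.
have off0 C : frame C -> hform (C *m col4 1 0 0 0) x != 0 ->
    exists B' k, [/\ frame B', k != 0 & B' *m col4 1 0 0 0 = k *: x].
  move=> Cf /(frame_hyperbolic Cf xr xx)[B' [k [B'f k0 _ B'3]]].
  exists (B' *m swap03 K), k; split=> //; first exact: frame_swap.
  by rewrite -mulmxA swap03_col4.
have off3 C : frame C -> hform (C *m col4 0 0 0 1) x != 0 ->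
    exists B' k, [/\ frame B', k != 0 & B' *m col4 1 0 0 0 = k *: x].
  move=> Cf C3; apply: (off0 (C *m swap03 K)); first exact: frame_swap.
  by rewrite -mulmxA swap03_col4.
have [/(off0 B)//|/negPn/eqP B0] := boolP (hform (B *m col4 1 0 0 0) x != 0); first exact.
have [/(off3 B)//|/negPn/eqP B3] := boolP (hform (B *m col4 0 0 0 1) x != 0); first exact.
(* When [x] is orthogonal to both, it is [(0, b, c, 0)]. The last basis vector is replaced by
   [(t, 1, 0, 1)], whose product with [x] is [sigma b]; and [b = 0] would force [c = 0]. *)
apply: (off3 (B *m heisenberg sigma t 1 0)).
  by apply: frame_heisenberg; rewrite // ?rmorph1 ?rmorph0 // tt mul1r mul0r addr0.
have [a [b [c [d xE]]]] := frame_coords x Bf.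
move: xx B0 B3; rewrite xE -mulmxA heisenberg_col4 !hform_frame //.
rewrite rmorph1 rmorph0 !(mul0r, mul1r, mulr0, mulr1, add0r, sub0r, addr0, subr0, oppr0).
move=> + /eqP + /eqP.
rewrite !oppr_eq0 !fmorph_eq0 => + /eqP d0 /eqP a0.
rewrite d0 a0 rmorph0 !(mul0r, mulr0, subr0) fmorph_eq0 => bc.
apply: contraNneq x0 => b0; move: bc; rewrite b0 mul0r add0r => /eqP.
rewrite mulf_eq0 fmorph_eq0 orbb => /eqP c0.
by rewrite xE a0 b0 c0 d0 col4_eq0 mulmx0.
Qed.

End IsotropicLines.

Lemma frobenius_rmorphism (R : comNzRingType) (p e : nat) : p \in [pchar R] ->
  exists sigma : {rmorphism R -> R}, forall x, sigma x = x ^+ (p ^ e).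
Proof.
move=> pR; elim: e => [|e [f fE]]; first by exists idfun => x; rewrite expr1.
exists (pFrobenius_aut pR \o f) => x /=.
by rewrite pFrobenius_autE fE -exprM -expnSr.
Qed.

(** * [F] as the fixed field of [sigma^2] *)

Section Rationality.
Variables (p e q : nat) (F : finFieldType) (K : fieldType).
Variables (iota : {rmorphism F -> K}) (sigma : {rmorphism K -> K}).
Hypotheses (p_prime : prime p) (e_gt0 : (0 < e)%N) (q_def : q = (p ^ e)%N).
Hypothesis cardF : #|F| = (q ^ 2)%N.
Hypothesis sigmaE : forall x, sigma x = x ^+ q.

Lemma sigma_iota a : sigma (iota a) = iota (a ^+ q).
Proof. by rewrite sigmaE rmorphXn. Qed.

Lemma sigma2_iota a : sigma (sigma (iota a)) = iota a.
Proof. by rewrite !sigma_iota (expfqq cardF). Qed.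

(** Such an [a] is a root of [X^(q^2) - X], which already splits over [F]. *)
Lemma sigma2_fixedP a : sigma (sigma a) = a -> exists b, a = iota b.
Proof.
rewrite !sigmaE -exprM mulnn -cardF => aF.
have : root (map_poly iota ('X^#|F| - 'X)) a.
  by rewrite rmorphB /= map_polyXn map_polyX rootE !hornerE aF subrr.
rewrite finField_genPoly rmorph_prod rootE horner_prod prodf_seq_eq0 => /hasP[b _].
by rewrite /= rmorphB /= map_polyX map_polyC !hornerE subr_eq0 => /eqP; exists b.
Qed.

Lemma rational_mapP m k (A : 'M[K]_(m, k)) :
  rational sigma A <-> exists A0, A = map_mx iota A0.
Proof.
split=> [/rationalE Ar|[A0 ->]]; last first.
  by apply/rationalE => i j; rewrite mxE sigma2_iota.
have A0P i j : exists b, A i j == iota b.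
  by have [b ->] := sigma2_fixedP (Ar i j); exists b.
exists (\matrix_(i, j) xchoose (A0P i j)); apply/matrixP => i j.
by rewrite !mxE; apply/eqP/(xchooseP (A0P i j)).
Qed.

(** Otherwise [X^q - X] would have [q^2] roots in [F]. The element found is the one that
    polarisation requires. *)
Lemma sigma_nontrivial : exists t, sigma t != t.
Proof.
have q1 := q_gt1 p_prime e_gt0 q_def.
suff [b bP] : exists b : F, b ^+ q != b.
  by exists (iota b); rewrite sigma_iota (inj_eq (fmorph_inj iota)).
apply/existsP; apply: contraT; rewrite negb_exists => /forallP bF.
have : (size (enum F) < size ('X^q - 'X : {poly F})%R)%N.
  apply: max_poly_roots; rewrite ?enum_uniq //.
    by rewrite -size_poly_eq0 size_polyDl size_polyXn // size_polyN size_polyX.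
  apply/allP => b _; have := bF b.
  by rewrite negbK rootE !hornerE subr_eq0.
rewrite size_polyDl size_polyXn ?size_polyN ?size_polyX // -cardE cardF ltnS.
by rewrite leqNgt -{1}(expn1 q) ltn_exp2l.
Qed.

Lemma trace_one : exists t, sigma (sigma t) = t /\ t + sigma t = 1.
Proof.
have q1 := q_gt1 p_prime e_gt0 q_def.
have /card_gt0P[z] : (0 < #|[set z : F | (z + z ^+ q)%R == 1%R]|)%N.
  by rewrite (card_trace_fiber p_prime e_gt0 q_def cardF) ?expr1n ?(ltnW q1).
rewrite inE => /eqP zP; exists (iota z).
by rewrite sigma2_iota sigma_iota -rmorphD zP rmorph1.
Qed.

End Rationality.

(** * The generalized quadrangle *)

Local Open Scope classical_set_scope.
Local Open Scope ring_scope.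

(** Transfers the counts of finite sets of coordinates to sets of points or lines of projective
    space, parametrised bijectively by [f]. *)
Lemma card_eq_II_image (I : finType) (T : Type) (S : {set I}) (f : I -> T)
    (A : set T) :
    {in S &, injective f} -> (forall i, i \in S -> A (f i)) ->
    (forall x, A x -> exists2 i, i \in S & f i = x) ->
  (A #= `I_#|S|)%card.
Proof.
move=> f_inj fS Sf.
have -> : A = (f \o enum_val) @` [set: 'I_#|S|].
  apply/seteqP; split=> [x /Sf[i iS <-]|_ [k _ <-]]; last exact/fS/enum_valP.
  by exists (enum_rank_in iS i) => //=; rewrite enum_rankK_in.
have -> : `I_#|S| = @nat_of_ord _ @` [set: 'I_#|S|].
  apply/seteqP; split=> [n n_lt|_ [k _ <-]]; last exact: ltn_ord.
  by exists (Ordinal n_lt).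
apply: card_eq_trans; last first.
  by rewrite card_eq_sym; apply: inj_card_eq => i j _ _; apply: ord_inj.
apply: inj_card_eq => i j _ _ /f_inj e.
by apply: enum_val_inj; apply: e; apply: enum_valP.
Qed.

Lemma dim_vline_neq0 (K : fieldType) (vT : vectType K) (x : vT) :
  x != 0 -> \dim <[x]>%VS == 1%N.
Proof. by move=> x0; rewrite dim_vline x0. Qed.

Definition point_of (K : fieldType) (n : nat) (x : 'cV[K]_n.+1) (x0 : x != 0)
  : ppoint K n := exist _ <[x]>%VS (dim_vline_neq0 x0).

Definition line_of (K : fieldType) (n : nat) (x y : 'cV[K]_n.+1)
    (x0 : x != 0) (yx : y \notin <[x]>%VS)
  : pline K n := exist _ (<[x]> + <[y]>)%VS (introT eqP (dim_span2 x0 yx)).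

Section Points.
Variables (K : fieldType) (n : nat).
Implicit Types (P Q : ppoint K n) (L M : pline K n) (x y : 'cV[K]_n.+1).

Lemma pointP P : exists2 x, x != 0 & val P = <[x]>%VS.
Proof.
have /eqP dP := valP P; have P0 : val P != 0%VS by rewrite -dimv_eq0 dP.
exists (vpick (val P)); first by rewrite vpick0.
apply/esym/eqP; rewrite eqEdim -memvE memv_pick dP dim_vline vpick0.
by rewrite P0.
Qed.

Lemma dim_line L : \dim (val L) = 2.
Proof. exact/eqP/(valP L). Qed.

Lemma on_lineE P L x : val P = <[x]>%VS -> on_line P L <-> x \in val L.
Proof. by rewrite /on_line => ->; rewrite memvE. Qed.

Lemma point_neq P Q x y : val P = <[x]>%VS -> val Q = <[y]>%VS -> P <> Q ->
  y \notin <[x]>%VS.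
Proof.
move=> Px Qy PQ; apply/vlineP => -[k yE]; apply: PQ; apply: val_inj.
rewrite Px Qy yE vlineZ //; apply/eqP => k0.
have /eqP := valP Q; rewrite Qy dim_vline yE k0 scale0r eqxx.
by [].
Qed.

Lemma line_neq_point P L x : val P = <[x]>%VS ->
  exists2 y, y \in val L & y \notin <[x]>%VS.
Proof.
move=> Px; apply/subvPn; apply/negP => /dimvS.
by have /eqP := valP P; rewrite Px dim_line => ->.
Qed.

Lemma two_points_line P Q L M : P <> Q ->
  on_line P L -> on_line Q L -> on_line P M -> on_line Q M -> L = M.
Proof.
have [x x0 Px] := pointP P; have [y y0 Qy] := pointP Q => PQ.
have yx := point_neq Px Qy PQ.
move=> /(on_lineE L Px) xL /(on_lineE L Qy) yL /(on_lineE M Px) xM /(on_lineE M Qy) yM.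
apply: val_inj; rewrite (dim2_span2 (dim_line L) xL yL x0 yx).
by rewrite (dim2_span2 (dim_line M) xM yM x0 yx).
Qed.

End Points.

Section Quadrangle.
Variables (p e q : nat) (F : finFieldType) (K : fieldType).
Variables (iota : {rmorphism F -> K}) (sigma : {rmorphism K -> K}).
Hypotheses (p_prime : prime p) (e_gt0 : (0 < e)%N) (q_def : q = (p ^ e)%N).
Hypothesis cardF : #|F| = (q ^ 2)%N.
Hypothesis sigmaE : forall x, sigma x = x ^+ q.
Variable B0 : 'M[K]_4.
Hypothesis B0f : frame sigma B0.

Notation hform := (hform sigma).
Notation rational := (rational sigma).
Notation isotropic := (isotropic sigma).
Notation frame := (frame sigma).
Notation X := (fermat_surface K q).
Notation V := (rational_points iota X).
Notation e0 := (col4 1 0 0 0).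
Notation e3 := (col4 0 0 0 1).
Implicit Types (P Q : ppoint K 3) (L M : pline K 3) (x y z : 'cV[K]_4).

Lemma fermat_surfaceP P : X P <-> forall x, x \in val P -> hform x x = 0.
Proof.
have hE x : hform x x = \sum_(i < 4) x i 0 ^+ q.+1.
  by rewrite hformE; apply: eq_bigr => i _; rewrite sigmaE exprS.
by split=> H x /H; rewrite hE.
Qed.

Lemma fermat_surface_vline P x : val P = <[x]>%VS -> X P <-> hform x x = 0.
Proof.
move=> Px; rewrite fermat_surfaceP Px; split=> [|xx _ /vlineP[k ->]].
  by apply; apply: memv_line.
by rewrite hformZl hformZr xx !mulr0.
Qed.

Lemma rational_pointP P : V P <->
  exists x, [/\ x != 0, rational x, hform x x = 0 & val P = <[x]>%VS].
Proof.
split=> [[XP [x0 Px]]|[x [x0 xr xx Px]]].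
  exists (map_mx iota x0); split=> //.
  - have /eqP := valP P; rewrite Px dim_vline; by case: eqP.
  - by apply/(rational_mapP iota cardF sigmaE); exists x0.
  - exact/(fermat_surface_vline Px).
split; first exact/(fermat_surface_vline Px).
by have /(rational_mapP iota cardF sigmaE)[y yE] := xr; exists y; rewrite Px yE.
Qed.

Lemma rational_point_frame P : V P ->
  exists2 B, frame B & val P = <[B *m e0]>%VS.
Proof.
case/rational_pointP => x [x0 xr xx Px].
have [t [tr t1]] := trace_one iota p_prime e_gt0 q_def cardF sigmaE.
have [B [k [Bf k0 BE]]] := frame_isotropic B0f tr t1 x0 xr xx.
by exists B => //; rewrite BE vlineZ.
Qed.

(** Each nonzero vector of the line spans one of its points, so [hform x x] vanishes throughout
    [val L], and [isotropic_quadric] polarises. *)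
Lemma lines_inP L : lines_in X L <-> isotropic (val L).
Proof.
split=> [XL|iL P /= PL]; last first.
  by apply/fermat_surfaceP => x /(subvP PL) xL; apply: iL.
have [t tP] := sigma_nontrivial iota p_prime e_gt0 q_def cardF sigmaE.
apply: (isotropic_quadric tP) => x xL.
have [->|x0] := eqVneq x 0; first by rewrite hform0l.
apply/(@fermat_surface_vline (point_of x0)) => //.
exact/XL/(@on_lineE _ _ (point_of x0) L x).
Qed.

Lemma frame_line_free B (z : K) : frame B ->
  B *m col4 0 1 z 0 \notin <[B *m e0]>%VS.
Proof.
move=> Bf; apply/vlineP => -[k].
rewrite scalemxAr col4Z => /(frame_inj Bf) /col4_inj[_ /eqP].
by rewrite mulr0 oner_eq0.
Qed.

(** In a frame with [P] spanned by the first basis vector, orthogonality to [P] means [d = 0]. The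
    lines are then spanned by [P] and [(0, 1, z, 0)] with [z^(q+1) = -1], which has [q + 1]
    solutions. *)
Lemma card_lines_through P : V P ->
  ([set L | lines_in X L /\ on_line P L] #= `I_q.+1)%card.
Proof.
case/rational_point_frame => B Bf PB.
have N1 : (-1 : F) != 0 by rewrite oppr_eq0 oner_eq0.
rewrite -(card_norm_fiber p_prime e_gt0 q_def cardF N1); last first.
  exact: (exprN1q p_prime e_gt0 q_def cardF).
pose f (z : F) := line_of (frame_e0_neq0 Bf) (frame_line_free (iota z) Bf).
apply: (@card_eq_II_image _ _ _ f).
- move=> z z' _ _ fE.
  have : B *m col4 0 1 (iota z') 0 \in val (f z).
    by rewrite fE /f /= memv_span2r.
  case/mem_span2P => a [b]; rewrite !scalemxAr -mulmxDr => /(frame_inj Bf).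
  rewrite !col4Z col4D => /col4_inj[_ b1 z'E _].
  move: b1 z'E; rewrite !mulr0 !mulr1 !add0r => <-; rewrite mul1r.
  by move/(fmorph_inj iota).
- move=> z; rewrite inE => /eqP zP; split; last first.
    by apply/(on_lineE _ PB); rewrite /= memv_span2l.
  apply/lines_inP/isotropic_span2; rewrite hform_frame //;
    rewrite ?(rmorph0, rmorph1, mul0r, mulr0, addr0, add0r, subr0, sub0r, oppr0) //.
  by rewrite mulr1 (sigma_iota iota sigmaE) -rmorphM -exprS zP rmorphN1 subrr.
- move=> L [/lines_inP iL /(on_lineE L PB) PL].
  have [y yL yP] := line_neq_point L PB.
  have [a [b [c [d yE]]]] := frame_coords y Bf.
  have := iL _ _ yL PL; have := iL _ _ yL yL; rewrite yE !hform_frame //.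
  rewrite ?(rmorph0, rmorph1, mulr0, mulr1, oppr0, add0r) => yy /eqP.
  rewrite oppr_eq0 => /eqP d0; move: yy; rewrite d0 rmorph0 mul0r mulr0 !subr0 => yy.
  have b0 : b != 0.
    apply: contraNneq yP => b0; move: yy; rewrite b0 mul0r add0r => /eqP.
    rewrite mulf_eq0 fmorph_eq0 orbb => /eqP c0; apply/vlineP; exists a.
    by rewrite yE b0 c0 d0 scalemxAr col4Z !mulr0 mulr1.
  have zN := norm_quotient b0 yy.
  have z0 : c / b != 0.
    by apply/eqP => z0; move/eqP: zN; rewrite z0 mul0r eq_sym oppr_eq0 oner_eq0.
  (* Norm [-1] gives [sigma z = - 1 / z], hence [sigma^2 z = z], so the slope lies in [F] although
     [L] was not assumed rational. *)
  have sz : sigma (c / b) = - (c / b)^-1.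
    by apply: (mulfI z0); rewrite zN mulrN divff.
  have [z zE] : exists z : F, c / b = iota z.
    apply: (sigma2_fixedP iota cardF sigmaE).
    by rewrite sz rmorphN fmorphV sz invrN opprK invrK.
  exists z.
    rewrite inE -(inj_eq (fmorph_inj iota)) exprS rmorphM -(sigma_iota iota sigmaE) -zE zN.
    by rewrite rmorphN1.
  apply/esym/val_inj/dim2_span2; rewrite ?dim_line ?(frame_e0_neq0 Bf) ?frame_line_free //.
  have -> : B *m col4 0 1 (iota z) 0 = b^-1 *: (y - a *: (B *m e0)).
    rewrite yE scalemxAr -mulmxBr scalemxAr; congr (B *m _).
    rewrite col4Z -scaleN1r col4Z col4D col4Z -zE d0.
    rewrite !(mulr0, mulr1, addr0) mulN1r subrr mulr0.
    by rewrite mulVf // [b^-1 * _]mulrC.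
  by apply/memvZ/memvB => //; apply: memvZ.
Qed.

(** The echelon basis [v, w] is rational, so the rational points are those spanned by [v + a w] with
    [a] in [F], together with the one spanned by [w]; the latter is the value at [None]. *)
Lemma card_points_on L : lines_in X L ->
  ([set P | V P /\ on_line P L] #= `I_(q ^ 2).+1)%card.
Proof.
move=> /lines_inP iL.
have [i [j [v [w [[vi vj wi wj] [vr wr] vL wL zE]]]]] :=
  isotropic_echelon (dim_line L) iL.
have w0 : w != 0.
  by apply/eqP => /matrixP/(_ j 0); rewrite wj mxE => /eqP; rewrite oner_eq0.
have va0 a : v + a *: w != 0.
  apply/eqP => /matrixP/(_ i 0); rewrite !mxE vi wi mulr0 addr0 => /eqP.
  by rewrite oner_eq0.
pose f (o : option F) : ppoint K 3 :=
  if o is Some a then point_of (va0 (iota a)) else point_of w0.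
rewrite -cardF -card_option -cardsT; apply: (@card_eq_II_image _ _ _ f).
- have wva a : w \notin <[v + a *: w]>%VS.
    apply/vlineP => -[k] wE; move/matrixP: (wE) => /(_ i 0).
    rewrite !mxE vi wi mulr0 addr0 mulr1 => k0.
    by case/eqP: (w0); rewrite wE -k0 scale0r.
  move=> [a|] [b|] _ _ // /(congr1 val) /= fE.
  + have /vlineP[k] : v + iota a *: w \in <[v + iota b *: w]>%VS.
      by rewrite -fE memv_line.
    move=> /matrixP ke; have := ke i 0; have := ke j 0.
    rewrite !mxE vi vj wi wj !(mulr0, mulr1, addr0, add0r) => + k1.
    by rewrite -k1 mul1r => /(fmorph_inj iota) ->.
  + by case/negP: (wva (iota a)); rewrite fE memv_line.
  + by case/negP: (wva (iota b)); rewrite -fE memv_line.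
- move=> o _; have fP (u : 'cV[K]_4) (u0 : u != 0) :
      rational u -> u \in val L -> V (point_of u0) /\ on_line (point_of u0) L.
    move=> ur uL; split; last exact/(@on_lineE _ _ _ _ u).
    by apply/rational_pointP; exists u; split=> //; apply: iL.
  case: o => [a|]; apply: fP => //.
    by apply: rationalD => //; apply: rationalZ; rewrite ?(sigma2_iota iota cardF sigmaE).
  by apply: memvD => //; apply: memvZ.
- move=> P [/rational_pointP[x [x0 xr xx Px]] /(on_lineE L Px)/zE xE].
  have [xi|xi] := eqVneq (x i 0) 0.
    exists None => //; apply: val_inj; rewrite /= Px xE xi scale0r add0r vlineZ //.
    by apply: contraNneq x0 => xj; rewrite xE xi xj !scale0r addr0.
  have /rationalE xr' := xr.
  have [a aE] : exists a, x j 0 / x i 0 = iota a.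
    by apply: (sigma2_fixedP iota cardF sigmaE); rewrite !rmorphM !fmorphV !xr'.
  exists (Some a) => //; apply: val_inj; rewrite /= Px -aE -(vlineZ _ xi).
  by rewrite scalerDr scalerA [x i 0 * _]mulrC divfK // -xE.
Qed.

Lemma collinearP P Q x y : rational y -> hform x x = 0 -> hform y y = 0 ->
  val P = <[x]>%VS -> val Q = <[y]>%VS -> P <> Q ->
  (exists L, [/\ lines_in X L, on_line P L & on_line Q L]) <-> hform x y = 0.
Proof.
move=> yr xx yy Px Qy PQ; split=> [[L [/lines_inP iL]]|xy].
  by move=> /(on_lineE L Px) xL /(on_lineE L Qy) yL; apply: iL.
have x0 : x != 0 by have /eqP := valP P; rewrite Px dim_vline; case: eqP.
exists (line_of x0 (point_neq Px Qy PQ)); split.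
- by apply/lines_inP/isotropic_span2; rewrite // (hform_sym0 yr xy).
- by apply/(on_lineE _ Px); rewrite /= memv_span2l.
- by apply/(on_lineE _ Qy); rewrite /= memv_span2r.
Qed.

(** The vector [y = hform w x *: v - hform v x *: w] spans the part of [L] orthogonal to [x]. It is
    nonzero because otherwise [x] would be orthogonal to all of [L], hence on [L]. *)
Lemma fermat_projection P L : V P -> lines_in X L -> ~ on_line P L ->
  exists! yM : ppoint K 3 * pline K 3,
    [/\ V yM.1, lines_in X yM.2, on_line P yM.2, on_line yM.1 yM.2 & on_line yM.1 L].
Proof.
case/rational_pointP => x [x0 xr xx Px] XL PL.
have /lines_inP iL := XL.
have [i [j [v [w [[vi vj wi wj] [vr wr] vL wL zE]]]]] :=
  isotropic_echelon (dim_line L) iL.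
have xL : x \notin val L by apply/negP => /(on_lineE L Px).
pose y := hform w x *: v - hform v x *: w.
have yi : y i 0 = hform w x by rewrite !mxE vi wi mulr1 mulr0 subr0.
have yj : y j 0 = - hform v x by rewrite !mxE vj wj mulr0 mulr1 add0r.
have yL : y \in val L by apply: memvB; apply: memvZ.
have yr : rational y.
  apply: rationalD; first by apply: rationalZ; rewrite // hform_rational.
  by rewrite -scaleNr; apply: rationalZ; rewrite // !rmorphN hform_rational.
have y0 : y != 0.
  apply: contraNneq xL => y0; apply: (isotropic_perp (dim_line L) iL) => z /zE ->.
  have := yi; have := yj; rewrite y0 !mxE => /esym/eqP.
  rewrite oppr_eq0 => /eqP vx /esym wx.
  by rewrite hformDr !hformZr (hform_sym0 xr vx) (hform_sym0 xr wx) !mulr0 addr0.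
have yx : hform y x = 0.
  by rewrite /y hformDl -scaleNr !hformZl mulNr mulrC subrr.
have Qy : val (point_of y0) = <[y]>%VS by [].
have PQ : P <> point_of y0.
  by move=> PQ; apply: PL; rewrite PQ; apply/(on_lineE L Qy).
have [M [XM PM QM]] : exists M,
    [/\ lines_in X M, on_line P M & on_line (point_of y0) M].
  by apply/(collinearP yr xx (iL _ _ yL yL) Px Qy PQ)/hform_sym0.
exists (point_of y0, M); split=> [|[Q' M'] [/= VQ' XM' PM' Q'M' Q'L]].
  split=> //.
  by apply/rational_pointP; exists y; split=> //; apply: iL.
suff QQ' : point_of y0 = Q'.
  by rewrite -QQ' in Q'M' *; congr pair; apply: (two_points_line PQ).
case/rational_pointP: VQ' => z [z0 _ _ Q'z].
have zL : z \in val L by apply/(on_lineE L Q'z).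
have zx : hform z x = 0.
  have /lines_inP iM' := XM'.
  by apply: iM'; [apply/(on_lineE M' Q'z)|apply/(on_lineE M' Px)].
(* A second point of [L] orthogonal to [x] would span [L] together with [y], again placing [x] on
   [L]. *)
apply: contrapT => /(point_neq Qy Q'z) zy; case/negP: xL.
apply: (isotropic_perp (dim_line L) iL) => u.
rewrite (dim2_span2 (dim_line L) yL zL y0 zy) => /mem_span2P[a [b ->]].
by apply: hform_sym0 => //; rewrite hformDl !hformZl yx zx !mulr0 addr0.
Qed.

Lemma fermat_quadrangle :
  generalized_quadrangle V (lines_in X) (@on_line K 3) (q ^ 2) q.
Proof.
have q1 := q_gt1 p_prime e_gt0 q_def.
split.
- by rewrite expn_gt0 (ltnW q1).
- exact: card_lines_through.
- exact: card_points_on.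
- move=> P Q L M _ _ _ _ PL QL PM QM; have [->|/eqP PQ] := eqVneq P Q; first by left.
  by right; apply: (two_points_line PQ).
- exact: fermat_projection.
Qed.

End Quadrangle.

(** * Curves and the complement of the point graph *)

Lemma lineP (K : fieldType) (n : nat) (L : pline K n) : exists x y,
  [/\ x != 0, y \notin <[x]>%VS & val L = (<[x]> + <[y]>)%VS].
Proof.
have L0 : val L != 0%VS by rewrite -dimv_eq0 dim_line.
have x0 : vpick (val L) != 0 by rewrite vpick0.
have [y yL yx] := line_neq_point L (erefl (val (point_of x0))).
exists (vpick (val L)), y; split=> //.
by apply: dim2_span2; rewrite ?dim_line ?memv_pick.
Qed.

(** * Action of projective maps on points and lines *)

Section ProjectiveMaps.
Variables (K : fieldType) (n : nat) (A : 'M[K]_n.+1).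
Hypothesis A_unit : A \in unitmx.

Lemma unitmx_mul_inj m : injective (mulmx A : 'M[K]_(n.+1, m) -> 'M[K]_(n.+1, m)).
Proof. exact/can_inj/mulKmx. Qed.

Lemma limg_mulmx_line (x : 'cV[K]_n.+1) : (linfun (mulmx A) @: <[x]>)%VS = <[A *m x]>%VS.
Proof. by rewrite limg_line lfunE. Qed.

Lemma dim_limg_mulmx (P : ppoint K n) :
  \dim (linfun (mulmx A) @: val P)%VS == 1%N.
Proof.
have [x x0 ->] := pointP P; rewrite limg_mulmx_line dim_vline.
by rewrite -(mulmx0 _ A) (inj_eq (@unitmx_mul_inj _)) x0.
Qed.

Definition pgl_map (P : ppoint K n) : ppoint K n :=
  exist _ (linfun (mulmx A) @: val P)%VS (dim_limg_mulmx P).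

Lemma pgl_map_PGL : PGL pgl_map.
Proof. by exists A. Qed.

Variable f : ppoint K n -> ppoint K n.
Hypothesis fA : forall P, val (f P) = (linfun (mulmx A) @: val P)%VS.

Lemma PGL_vline P x : val P = <[x]>%VS -> val (f P) = <[A *m x]>%VS.
Proof. by rewrite fA => ->; rewrite limg_mulmx_line. Qed.

Lemma PGL_on_line P (L M : pline K n) : val L = (linfun (mulmx A) @: val M)%VS ->
  on_line (f P) L <-> on_line P M.
Proof.
move=> LM; have [x x0 Px] := pointP P.
rewrite (on_lineE _ Px) (on_lineE _ (PGL_vline Px)) LM; split=> [/memv_imgP[y yM]|xM].
  by rewrite lfunE => /unitmx_mul_inj ->.
by rewrite -[A *m x](lfunE (mulmx A)) memv_img.
Qed.

Lemma PGL_inj : injective f.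
Proof.
move=> P Q fPQ; have [x _ Px] := pointP P; have [y _ Qy] := pointP Q.
apply: contrapT => /(point_neq Px Qy) /vlineP; apply.
have : A *m y \in <[A *m x]>%VS.
  by rewrite -(PGL_vline Px) fPQ (PGL_vline Qy) memv_line.
by case/vlineP => k; rewrite scalemxAr => /unitmx_mul_inj ->; exists k.
Qed.

Lemma PGL_preimage_line (L : pline K n) : exists M : pline K n,
  val L = (linfun (mulmx A) @: val M)%VS.
Proof.
have [x [y [x0 yx LE]]] := lineP L.
have x0' : invmx A *m x != 0.
  by apply: contraNneq x0 => xE; rewrite -(mulKVmx A_unit x) xE mulmx0.
have yx' : invmx A *m y \notin <[invmx A *m x]>%VS.
  apply: contraNN yx => /vlineP[k yE]; apply/vlineP; exists k.
  by rewrite -(mulKVmx A_unit y) yE -scalemxAr mulKVmx.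
exists (line_of x0' yx'); rewrite LE /=.
by rewrite limgD !limg_mulmx_line !mulKVmx.
Qed.

Lemma PGL_preimage_lines_in (Y : set (ppoint K n)) (L M : pline K n) : f @` Y = Y ->
  val L = (linfun (mulmx A) @: val M)%VS -> lines_in Y L -> lines_in Y M.
Proof.
move=> fY LM YL P /(PGL_on_line P LM)/YL; rewrite -[in Y _]fY => -[Q YQ].
by move/PGL_inj <-.
Qed.

End ProjectiveMaps.

Section CurveGraph.
Variables (p e q : nat) (F : finFieldType) (K : fieldType).
Variables (iota : {rmorphism F -> K}) (sigma : {rmorphism K -> K}).
Hypotheses (p_prime : prime p) (e_gt0 : (0 < e)%N) (q_def : q = (p ^ e)%N).
Hypothesis cardF : #|F| = (q ^ 2)%N.
Hypothesis sigmaE : forall x, sigma x = x ^+ q.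
Variable B0 : 'M[K]_4.
Hypothesis B0f : frame sigma B0.

Notation hform := (hform sigma).
Notation rational := (rational sigma).
Notation frame := (frame sigma).
Notation X := (fermat_surface K q).
Notation V := (rational_points iota X).
Notation e0 := (col4 1 0 0 0).
Notation e3 := (col4 0 0 0 1).
Notation C0 := (rational_curve q B0).
Notation collinear P Q :=
  (exists L, [/\ lines_in X L, on_line P L & on_line Q L]).
Implicit Types (P Q : ppoint K 3) (L M : pline K 3) (x y z : 'cV[K]_4).

Let linesP := lines_inP iota p_prime e_gt0 q_def cardF sigmaE.

Lemma two_lines_through P : V P -> exists L M,
  [/\ L <> M, lines_in X L, lines_in X M, on_line P L & on_line P M].
Proof.
have q1 := q_gt1 p_prime e_gt0 q_def.
move/(card_lines_through p_prime e_gt0 q_def cardF sigmaE B0f).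
(* There are [q + 1 >= 2] lines through [P]; exposing [q] as a successor lets a second one be
   extracted. *)
case/eq_cardSP => L [XL PL]; rewrite -[X in (_ #= `I_X)%card](prednK (ltnW q1)).
case/eq_cardSP => M [[XM PM] ML] _; exists L, M; split=> //.
by move=> LM; apply: ML; rewrite LM.
Qed.

(* [f] need not a priori preserve rationality, but [P] is the intersection of
   two lines of the surface, and those are all stable under [frob2]. *)
Lemma aut_frob2 f P z : projective_aut X f -> V (f P) -> val P = <[z]>%VS ->
  frob2 sigma z \in <[z]>%VS.
Proof.
move=> [[A Au fA] fX] /two_lines_through[L [M [LM XL XM PL PM]]] Pz.
have [L' LE] := PGL_preimage_line Au L; have [M' ME] := PGL_preimage_line Au M.
have /linesP iL' := PGL_preimage_lines_in Au fA fX LE XL.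
have /linesP iM' := PGL_preimage_lines_in Au fA fX ME XM.
move/(PGL_on_line Au fA P LE)/(on_lineE _ Pz): PL => zL.
move/(PGL_on_line Au fA P ME)/(on_lineE _ Pz): PM => zM.
have z0 : z != 0 by have /eqP := valP P; rewrite Pz dim_vline; case: eqP.
apply/negPn/negP => zz; apply: LM; apply: val_inj; rewrite LE ME.
rewrite (dim2_span2 (dim_line L') zL (isotropic_frob2 (dim_line L') iL' zL) z0 zz).
by rewrite (dim2_span2 (dim_line M') zM (isotropic_frob2 (dim_line M') iM' zM) z0 zz).
Qed.

Lemma curve_paramE s t : curve_param q s t
  = col4 (s * sigma s) (sigma s * t) (s * sigma t) (t * sigma t).
Proof. by rewrite !sigmaE -!exprS. Qed.

Lemma hform_curve s t s' t' :
  hform (B0 *m curve_param q s t) (B0 *m curve_param q s' t')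
  = - (sigma (s * t' - t * s')
       * (s * sigma (sigma t') - t * sigma (sigma s'))).
Proof.
by rewrite !curve_paramE hform_frame // !(rmorphM, rmorphB) /=; ring.
Qed.

(** The ratio of the first two coordinates of the curve recovers [t / s], so a point fixed by
    [sigma^2] has its parameter fixed as well. *)
Lemma curve_frob2 s t :
  frob2 sigma (B0 *m curve_param q s t) \in <[B0 *m curve_param q s t]>%VS ->
  s * sigma (sigma t) = t * sigma (sigma s).
Proof.
have [Br _] := B0f.
rewrite curve_paramE /frob2 !map_mxM [map_mx sigma (map_mx sigma B0)]Br !map_col4.
case/vlineP => k; rewrite scalemxAr col4Z => /(frame_inj B0f)/col4_inj[e0 e1 _ _].
have [->|s0] := eqVneq s 0; first by rewrite !rmorph0 mul0r mulr0.
move: e0 e1; rewrite !rmorphM.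
set s1 := sigma s; set s2 := sigma s1; set s3 := sigma s2; set t2 := sigma (sigma t).
move=> e0 e1.
have s10 : s1 != 0 by rewrite fmorph_eq0.
have s30 : s3 != 0 by rewrite !fmorph_eq0.
apply: (mulfI s30); apply: (mulfI s10).
transitivity (s * s1 * (s3 * t2)); first by ring.
rewrite e1; transitivity (t * s1 * (k * (s * s1))); first by ring.
by rewrite -e0; ring.
Qed.

(** The parametrisation is homogeneous of degree [q + 1]: scaling the parameters by [k] scales the
    vector by [k * sigma k]. *)
Lemma curve_param_prop (s t s' t' : K) : (s', t') <> (0, 0) -> s * t' = t * s' ->
  exists k, curve_param q s t = k *: curve_param q s' t'.
Proof.
move=> st0 st.
have [k [-> ->]] : exists k, s = k * s' /\ t = k * t'.
  have [s0|s0] := eqVneq s' 0.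
    have t0 : t' != 0 by apply/eqP => t0; apply: st0; rewrite s0 t0.
    exists (t / t'); split; last by rewrite divfK.
    by move/eqP: st; rewrite s0 !mulr0 mulf_eq0 (negPf t0) orbF => /eqP.
  by exists (s / s'); rewrite divfK // mulrAC st mulfK.
exists (k * sigma k); rewrite !curve_paramE col4Z !rmorphM /=.
by congr col4; ring.
Qed.

(** Pulling a common line back through the automorphism gives an isotropic plane containing two
    points of [C0], so one of the factors in [hform_curve] vanishes. Since the parameter of [Q'] is
    fixed by [sigma^2], either factor makes the two parameters proportional. *)
Lemma orbit_not_collinear C P Q : aut_orbit X C0 C -> V P -> V Q -> P <> Q ->
  C P -> C Q -> ~ collinear P Q.
Proof.
move=> [f fX ->] VP VQ PQ [P' [s [t [_ P'E]]] fP] [Q' [s' [t' [st0' Q'E]]] fQ].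
move=> [L [XL PL QL]].
have PQ' : Q' <> P' by move=> Q'P'; apply: PQ; rewrite -fP -fQ Q'P'.
rewrite -fQ in VQ QL; rewrite -fP in PL.
have /curve_frob2 st' := aut_frob2 fX VQ Q'E.
have [[A Au fA] fXX] := fX.
have [M LE] := PGL_preimage_line Au L.
have /linesP iM := PGL_preimage_lines_in Au fA fXX LE XL.
move/(PGL_on_line Au fA _ LE)/(on_lineE _ P'E): PL => xM.
move/(PGL_on_line Au fA _ LE)/(on_lineE _ Q'E): QL => yM.
case/negP: (point_neq Q'E P'E PQ').
suff /(curve_param_prop st0')[k ->] : s * t' = t * s'.
  by rewrite -scalemxAr memvZ ?memv_line.
apply/eqP; rewrite -subr_eq0; have /eqP := iM _ _ xM yM.
rewrite hform_curve oppr_eq0 mulf_eq0 fmorph_eq0 => /orP[//|/eqP/subr0_eq st].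
have [s0|s0] := eqVneq s' 0.
  have t0 : t' != 0 by apply/eqP => t0; apply: st0'; rewrite s0 t0.
  move/eqP: st; rewrite s0 !rmorph0 !mulr0 subr0 !mulf_eq0 !fmorph_eq0 (negPf t0) orbF.
  by move->.
have ss0 : sigma (sigma s') != 0 by rewrite !fmorph_eq0.
rewrite subr_eq0; apply/eqP/(mulIf ss0).
by rewrite -mulrA -st' mulrCA st; ring.
Qed.

(** Both frames have Gram matrix [matJ], so [B *m invmx B0] is unitary and preserves the surface. *)
Lemma frame_aut B : frame B ->
  exists2 f, projective_aut X f &
    forall P u, val P = <[B0 *m u]>%VS -> val (f P) = <[B *m u]>%VS.
Proof.
move=> Bf; have B0u := frame_unit B0f; have Bu := frame_unit Bf.
have Au : B *m invmx B0 \in unitmx by rewrite unitmx_mul Bu unitmx_inv.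
set A := B *m invmx B0 in Au.
have hA x : hform (A *m x) (A *m x) = hform x x.
  have [a [b [c [d ->]]]] := frame_coords x B0f.
  by rewrite /A -mulmxA mulKmx // !hform_frame.
have fA P : val (pgl_map Au P) = (linfun (mulmx A) @: val P)%VS by [].
exists (pgl_map Au); last first.
  by move=> P u Pu; rewrite (PGL_vline fA Pu) /A -mulmxA mulKmx.
split; first exact: pgl_map_PGL.
apply/seteqP; split=> [_ [P XP <-]|P XP]; have [x x0 Px] := pointP P.
  apply/(fermat_surface_vline sigmaE (PGL_vline fA Px)); rewrite hA.
  exact/(fermat_surface_vline sigmaE Px).
have y0 : invmx A *m x != 0.
  by apply: contraNneq x0 => xE; rewrite -(mulKVmx Au x) xE mulmx0.
exists (point_of y0).
  apply/(fermat_surface_vline sigmaE (erefl (val (point_of y0)))).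
  by rewrite -hA mulKVmx //; apply/(fermat_surface_vline sigmaE Px).
by apply: val_inj; rewrite (PGL_vline fA (erefl (val (point_of y0)))) mulKVmx.
Qed.

(** [frame_isotropic] moves the first basis vector to [P]; [frame_hyperbolic] then moves the last
    one to [Q] while keeping the first. *)
Lemma hyperbolic_frame P Q x y : rational x -> rational y -> x != 0 ->
  hform x x = 0 -> hform y y = 0 -> val P = <[x]>%VS -> val Q = <[y]>%VS ->
  hform x y != 0 -> exists B,
    [/\ frame B, val P = <[B *m e0]>%VS & val Q = <[B *m e3]>%VS].
Proof.
move=> xr yr x0 xx yy Px Qy xy.
have [t [tr t1]] := trace_one iota p_prime e_gt0 q_def cardF sigmaE.
have [B [k [Bf k0 BE]]] := frame_isotropic B0f tr t1 x0 xr xx.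
have : hform (B *m e0) y != 0 by rewrite BE hformZl mulf_neq0.
case/(frame_hyperbolic Bf yr yy) => B' [l [B'f l0 B'0 B'3]].
by exists B'; rewrite B'0 B'3 BE !vlineZ.
Qed.

Lemma curve_graphE : curve_graph V (aut_orbit X C0)
  = complement_graph (point_graph V (lines_in X) (@on_line K 3)).
Proof.
congr Graph; apply/funext => P; apply/funext => Q; apply/propext; split.
  move=> [VP VQ PQ [C [OC CP CQ]]]; split=> // -[_ _ _].
  exact: orbit_not_collinear OC VP VQ PQ CP CQ.
move=> [VP VQ PQ nPQ]; split=> //.
have [x [x0 xr xx Px]] := proj1 (rational_pointP iota cardF sigmaE P) VP.
have [y [y0 yr yy Qy]] := proj1 (rational_pointP iota cardF sigmaE Q) VQ.
have xy : hform x y != 0.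
  apply/eqP => xy; apply: nPQ; split=> //.
  exact/(collinearP iota p_prime e_gt0 q_def cardF sigmaE yr xx yy Px Qy PQ).
have [B [Bf PB QB]] := hyperbolic_frame xr yr x0 xx yy Px Qy xy.
have [f fX fB] := frame_aut Bf.
have onC u R : val R = <[B *m u]>%VS -> u != 0 ->
   (exists s t : K, (s, t) <> (0, 0) /\ u = curve_param q s t) -> (f @` C0) R.
  move=> Ru u0 [s [t [st0 uE]]].
  have Bu0 : B0 *m u != 0.
    by rewrite -(mulmx0 _ B0) (inj_eq (@unitmx_mul_inj _ _ _ (frame_unit B0f) _)).
  exists (point_of Bu0); first by exists s, t; rewrite -uE.
  by apply: val_inj; rewrite Ru; apply: fB.
(* The parameters [(1, 0)] and [(0, 1)] give the first and last basis vectors, so the image of [C0]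
   passes through [P] and [Q]. *)
exists (f @` C0); split; first by exists f.
  apply: (onC e0) => //.
    by rewrite -col4_eq0; apply/eqP => /col4_inj[/eqP]; rewrite oner_eq0.
  exists 1, 0; split; first by case=> /eqP; rewrite oner_eq0.
  by rewrite curve_paramE rmorph1 rmorph0 !(mulr0, mulr1).
apply: (onC e3) => //.
  by rewrite -col4_eq0; apply/eqP => /col4_inj[_ _ _ /eqP]; rewrite oner_eq0.
exists 0, 1; split; first by case=> /eqP; rewrite oner_eq0.
by rewrite curve_paramE rmorph1 rmorph0 !(mul0r, mulr1).
Qed.

End CurveGraph.

(** * Strong regularity *)

(** Index set for the vertices, which fall into three strata: a single point and two families. *)
Lemma card_option_sum (A B : finType) (S : {set A}) (T : {set B}) :
  #|[set o : option (A + B) |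
      match o with Some (inl a) => a \in S | Some (inr b) => b \in T | None => true end]%SET|
  = (1 + #|S| + #|T|)%N.
Proof.
set U := [set o | _]%SET.
have -> : U = (None |: (Some @: (inl @: S :|: inr @: T)))%SET.
  apply/setP => o; rewrite !inE; case: o => [o|]; last by rewrite eqxx.
  rewrite /= (mem_imset _ _ (@Some_inj _)) inE; case: o => [a|b].
    rewrite (mem_imset _ _ (@inl_inj _ _)); case: (a \in S) => //=.
    by apply/esym/imsetP => -[].
  rewrite (mem_imset _ _ (@inr_inj _ _)) orbC; case: (b \in T) => //=.
  by apply/esym/imsetP => -[].
rewrite cardsU1 (card_imset _ (@Some_inj _)) cardsU (card_imset _ (@inl_inj _ _)).
rewrite (card_imset _ (@inr_inj _ _)) (_ : _ :&: _ = finset.set0)%SET.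
  rewrite cards0 subn0 addnA; congr (_ + _ + _)%N.
  by case: imsetP => // -[].
by apply/setP => o; rewrite !inE; apply/andP => -[/imsetP[a _ ->] /imsetP[]].
Qed.

Section SRG.
Variables (p e q : nat) (F : finFieldType) (K : fieldType).
Variables (iota : {rmorphism F -> K}) (sigma : {rmorphism K -> K}).
Hypotheses (p_prime : prime p) (e_gt0 : (0 < e)%N) (q_def : q = (p ^ e)%N).
Hypothesis cardF : #|F| = (q ^ 2)%N.
Hypothesis sigmaE : forall x, sigma x = x ^+ q.
Variable B0 : 'M[K]_4.
Hypothesis B0f : frame sigma B0.

Notation hform := (hform sigma).
Notation rational := (rational sigma).
Notation frame := (frame sigma).
Notation X := (fermat_surface K q).
Notation V := (rational_points iota X).
Notation e0 := (col4 1 0 0 0).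
Notation e3 := (col4 0 0 0 1).
Notation G := (complement_graph (point_graph V (lines_in X) (@on_line K 3))).
Implicit Types (P Q : ppoint K 3) (x y z : 'cV[K]_4).

Let ratP := rational_pointP iota cardF sigmaE.

(** Distinctness follows from [hform x y != 0]: for equal points this value would be a multiple of
    [hform x x = 0]. *)
Lemma complement_adjacentP P Q x y : V P -> V Q -> rational y ->
    hform x x = 0 -> hform y y = 0 -> val P = <[x]>%VS -> val Q = <[y]>%VS ->
  adjacent G P Q <-> hform x y != 0.
Proof.
move=> VP VQ yr xx yy Px Qy; split=> /= [[_ _ PQ nPQ]|xy].
  apply/eqP => xy; apply: nPQ; split=> //.
  exact/(collinearP iota p_prime e_gt0 q_def cardF sigmaE yr xx yy Px Qy PQ).
have PQ : P <> Q.
  move=> PQ; have /vlineP[k xE] : y \in <[x]>%VS by rewrite -Px PQ Qy memv_line.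
  by move: xy; rewrite xE hformZr xx mulr0 eqxx.
split=> // -[_ _ _].
move/(collinearP iota p_prime e_gt0 q_def cardF sigmaE yr xx yy Px Qy PQ) => xy0.
by rewrite xy0 eqxx in xy.
Qed.

Lemma affine_neq0 B a b c : frame B -> B *m col4 a b c 1 != 0.
Proof. by move=> Bf; apply: (frame_col_neq0 Bf); rewrite oner_neq0 !orbT. Qed.

Definition affine_col (t : F * (F * F)) :=
  col4 (iota t.1) (iota t.2.1) (iota t.2.2) 1.

Definition affine_point B (Bf : frame B) (t : F * (F * F)) : ppoint K 3 :=
  point_of (affine_neq0 (iota t.1) (iota t.2.1) (iota t.2.2) Bf).

Lemma val_affine_point B (Bf : frame B) t :
  val (affine_point Bf t) = <[B *m affine_col t]>%VS.
Proof. by []. Qed.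

Lemma affine_col_rational B t : frame B -> rational (B *m affine_col t).
Proof.
move=> Bf; apply/(frame_rational _ Bf)/rational_col4.
by rewrite !(sigma2_iota iota cardF sigmaE) !rmorph1.
Qed.

Lemma affine_col_isotropic B t : frame B ->
  hform (B *m affine_col t) (B *m affine_col t) = 0 <-> t \in affine_pts q F.
Proof.
move=> Bf; rewrite hform_frame // rmorph1 mulr1 mul1r !(sigma_iota iota sigmaE).
rewrite inE -!rmorphM -rmorphD -!rmorphB -!exprS.
rewrite -addrA -opprD /= eq_sym -subr_eq0 -(fmorph_eq0 iota).
by split=> /eqP.
Qed.

Lemma affine_point_inj B (Bf : frame B) : injective (affine_point Bf).
Proof.
move=> [a [b c]] [a' [b' c']] /(congr1 val) /= ptE.
have : B *m affine_col (a, (b, c)) \in <[B *m affine_col (a', (b', c'))]>%VS.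
  by rewrite -ptE memv_line.
case/vlineP => k; rewrite scalemxAr col4Z => /(frame_inj Bf)/col4_inj[].
rewrite /= mulr1 => + + + k1; rewrite -k1 !mul1r.
by move=> /(fmorph_inj iota)-> /(fmorph_inj iota)-> /(fmorph_inj iota)->.
Qed.

Lemma affine_point_V B (Bf : frame B) t :
  t \in affine_pts q F -> V (affine_point Bf t).
Proof.
move=> /(affine_col_isotropic t Bf) tt; apply/ratP.
exists (B *m affine_col t); split=> //; first exact: affine_neq0.
exact: affine_col_rational.
Qed.

Lemma affine_pointP B (Bf : frame B) Q a b c d : V Q ->
  val Q = <[B *m col4 a b c d]>%VS -> d != 0 -> rational (B *m col4 a b c d) ->
  exists2 t, t \in affine_pts q F & affine_point Bf t = Q.
Proof.
move=> [XQ _] Qy d0 /(frame_rational _ Bf)/rational_col4[ar br cr dr].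
have fixP u : sigma (sigma u) = u -> exists v, u / d = iota v.
  by move=> ur; apply: (sigma2_fixedP iota cardF sigmaE); rewrite !rmorphM !fmorphV ur dr.
have [a1 aE] := fixP _ ar; have [b1 bE] := fixP _ br; have [c1 cE] := fixP _ cr.
pose t := (a1, (b1, c1)).
have Qt : val Q = <[B *m affine_col t]>%VS.
  have d10 : d^-1 != 0 by rewrite invr_eq0.
  rewrite Qy -(vlineZ _ d10) scalemxAr col4Z mulVf //.
  by rewrite ![d^-1 * _]mulrC aE bE cE.
exists t; last exact: val_inj.
exact/(affine_col_isotropic t Bf)/(fermat_surface_vline sigmaE Qt).
Qed.

Lemma frame_e0_V B P : frame B -> val P = <[B *m e0]>%VS -> V P.
Proof.
move=> Bf PB; apply/ratP; exists (B *m e0); split=> //.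
- exact: frame_e0_neq0 Bf.
- by apply/(frame_rational _ Bf)/rational_col4; rewrite !rmorph0 !rmorph1.
- by rewrite hform_frame // !rmorph0 !(mulr0, mul0r, addr0, subr0).
Qed.

(** The product of [B *m e0] with a vector of last coordinate [d] is [- sigma d], so the neighbours
    of [P] fill the affine chart [d = 1]. *)
Lemma neighbours_frameP B (Bf : frame B) P Q : val P = <[B *m e0]>%VS ->
  neighbours G P Q <-> exists2 t, t \in affine_pts q F & affine_point Bf t = Q.
Proof.
move=> PB; have VP := frame_e0_V Bf PB.
have ee : hform (B *m e0) (B *m e0) = 0.
  by rewrite hform_frame // !rmorph0 !(mulr0, mul0r, addr0, subr0).
split=> [[VQ PQ]|[t tA <-]]; last first.
  have Vt := affine_point_V Bf tA; split=> //.
  apply/(complement_adjacentP VP Vt (affine_col_rational t Bf) ee _ PB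
    (val_affine_point Bf t)); first exact/(affine_col_isotropic t Bf).
  rewrite hform_frame // rmorph1 !(mul0r, mulr1, addr0, sub0r, subr0).
  by rewrite oppr_eq0 oner_neq0.
have [y [y0 yr yy Qy]] := proj1 (ratP Q) VQ.
move/(complement_adjacentP VP VQ yr ee yy PB Qy): PQ.
have [a [b [c [d yE]]]] := frame_coords y Bf; rewrite yE in yr Qy *.
rewrite hform_frame // !(mul0r, mul1r, addr0, sub0r, subr0) oppr_eq0 fmorph_eq0 => d0.
exact: affine_pointP Bf Q a b c d VQ Qy d0 yr.
Qed.

Lemma card_neighbours P : V P -> (neighbours G P #= `I_(q ^ 5))%card.
Proof.
case/(rational_point_frame p_prime e_gt0 q_def cardF sigmaE B0f) => B Bf PB.
rewrite -(card_affine_pts p_prime e_gt0 q_def cardF).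
apply: (@card_eq_II_image _ _ _ (affine_point Bf)).
- by move=> ? ? _ _; apply: affine_point_inj.
- by move=> t tA; apply/(neighbours_frameP Bf _ PB); exists t.
- by move=> Q /(neighbours_frameP Bf _ PB).
Qed.

Lemma card_common_neighbours B (Bf : frame B) P Q y (S : {set F * (F * F)}) :
    val P = <[B *m e0]>%VS -> V Q -> rational y -> hform y y = 0 ->
    val Q = <[y]>%VS ->
    (forall t, (t \in S) = (t \in affine_pts q F) && (hform (B *m affine_col t) y != 0)) ->
  (neighbours G P `&` neighbours G Q #= `I_#|S|)%card.
Proof.
move=> PB VQ yr yy Qy SE.
have adjE t : t \in affine_pts q F ->
    adjacent G Q (affine_point Bf t) <-> hform (B *m affine_col t) y != 0.
  move=> tA; have tr := affine_col_rational t Bf.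
  have /(affine_col_isotropic t Bf) tt := tA.
  have := complement_adjacentP VQ (affine_point_V Bf tA) tr yy tt Qy
    (val_affine_point Bf t).
  move=> ->; split; apply: contraNneq => ty; apply/eqP; exact: (hform_sym0 _ ty).
apply: (@card_eq_II_image _ _ _ (affine_point Bf)).
- by move=> ? ? _ _; apply: affine_point_inj.
- move=> t; rewrite SE => /andP[tA /(adjE _ tA) tQ]; split.
    by apply/(neighbours_frameP Bf _ PB); exists t.
  by split=> //; apply: affine_point_V.
- move=> R [/(neighbours_frameP Bf _ PB)[t tA <-] [_ /(adjE _ tA) tQ]].
  by exists t; rewrite // SE tA.
Qed.

(** In a frame with [P] first and [Q] last, an affine neighbour [(a, b, c, 1)] of [P] has product
    [- a] with [Q], so the condition is [a != 0]. *)
Lemma card_common_neighbours_adjacent P Q : V P -> V Q -> adjacent G P Q ->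
  (neighbours G P `&` neighbours G Q
     #= `I_(q * (q - 1) * (q ^ 3 + q ^ 2 - 1)))%card.
Proof.
move=> VP VQ PQ.
have [x [x0 xr xx Px]] := proj1 (ratP P) VP.
have [y [y0 yr yy Qy]] := proj1 (ratP Q) VQ.
move/(complement_adjacentP VP VQ yr xx yy Px Qy): PQ => xy.
have [B [Bf PB QB]] := hyperbolic_frame iota p_prime e_gt0 q_def cardF sigmaE B0f
  xr yr x0 xx yy Px Qy xy.
rewrite -(card_affine_pts_neq0 p_prime e_gt0 q_def cardF).
apply: (card_common_neighbours Bf PB VQ _ _ QB).
- by apply/(frame_rational _ Bf)/rational_col4; rewrite !rmorph0 !rmorph1.
- by rewrite hform_frame // !rmorph0 !(mulr0, mul0r, addr0, subr0).
- move=> t; rewrite inE hform_frame // !rmorph0 rmorph1 !(mulr0, mulr1).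
  by rewrite addr0 sub0r subr0 oppr_eq0 fmorph_eq0.
Qed.

(** In a frame at [P], orthogonality puts [Q] at [(a, b, c, 0)], and [Q <> P] gives [b != 0].
    Non-orthogonality to [Q] then excludes one affine line in the two middle coordinates. *)
Lemma card_common_neighbours_nonadjacent P Q : V P -> V Q -> P <> Q ->
  ~ adjacent G P Q ->
  (neighbours G P `&` neighbours G Q #= `I_(q ^ 3 * (q ^ 2 - 1)))%card.
Proof.
move=> VP VQ nPQ PQ.
have [B Bf PB] := rational_point_frame p_prime e_gt0 q_def cardF sigmaE B0f VP.
have [y [y0 yr yy Qy]] := proj1 (ratP Q) VQ.
have ee : hform (B *m e0) (B *m e0) = 0.
  by rewrite hform_frame // !rmorph0 !(mulr0, mul0r, addr0, subr0).
have ey : hform (B *m e0) y = 0.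
  apply: contra_notP PQ => /eqP ey.
  exact/(complement_adjacentP VP VQ yr ee yy PB Qy).
have yP := point_neq PB Qy nPQ.
have [a [b [c [d yE]]]] := frame_coords y Bf.
move: (yr) (yy) ey; rewrite yE => /(frame_rational _ Bf)/rational_col4[ar br cr dr].
rewrite !hform_frame // => bc /eqP.
rewrite !(mul0r, mul1r, addr0, sub0r, subr0) oppr_eq0 fmorph_eq0 => /eqP d0.
move: bc; rewrite d0 rmorph0 mul0r mulr0 !subr0 => bc.
have b0 : b != 0.
  apply: contraNneq yP => b0; move: bc; rewrite b0 mul0r add0r => /eqP.
  rewrite mulf_eq0 fmorph_eq0 orbb => /eqP c0; apply/vlineP; exists a.
  by rewrite yE b0 c0 d0 scalemxAr col4Z !mulr0 mulr1.
have [a1 aE] := sigma2_fixedP iota cardF sigmaE ar.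
have [b1 bE] := sigma2_fixedP iota cardF sigmaE br.
have [c1 cE] := sigma2_fixedP iota cardF sigmaE cr.
have b10 : b1 ^+ q != 0.
  by rewrite expf_neq0 // -(fmorph_eq0 iota) -bE.
(* The coefficients are the conjugates of those of [Q], since the form is semilinear in its second
   argument. *)
rewrite -(card_affine_pts_off_line p_prime e_gt0 q_def cardF (c1 ^+ q) (- a1 ^+ q) b10).
apply: (card_common_neighbours Bf PB VQ yr yy Qy) => t.
rewrite inE yE hform_frame // aE bE cE d0 rmorph0 mulr0 subr0 mul1r.
rewrite !(sigma_iota iota sigmaE) -!rmorphM -rmorphD -rmorphB fmorph_eq0.
by rewrite [t.2.1 * _]mulrC [t.2.2 * _]mulrC.
Qed.

(** In frame coordinates [(a, b, c, d)]: [d != 0] gives the [q^5] affine points; [d = 0] and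
    [b != 0] gives [(a, 1, z, 0)] with [z^(q+1) = -1], that is [q^2 (q + 1)] points; [d = b = 0]
    forces [c = 0] and leaves one point. *)
Lemma card_vertices : (V #= `I_((q ^ 3 + 1) * (q ^ 2 + 1)))%card.
Proof.
pose N := [set z : F | z ^+ q.+1 == -1]%SET.
have cN : #|N| = q.+1.
  apply: (card_norm_fiber p_prime e_gt0 q_def cardF); first by rewrite oppr_eq0 oner_eq0.
  exact: (exprN1q p_prime e_gt0 q_def cardF).
have -> : ((q ^ 3 + 1) * (q ^ 2 + 1)
    = 1 + #|affine_pts q F| + #|finset.setX [set: F]%SET N|)%N.
  rewrite cardsX cardsT cN cardF (card_affine_pts p_prime e_gt0 q_def cardF).
  by ring.
have pe : B0 *m e0 != 0 := frame_e0_neq0 B0f.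
have pz (a z : K) : B0 *m col4 a 1 z 0 != 0.
  by apply: (frame_col_neq0 B0f); rewrite oner_neq0 orbT.
pose f (o : option (F * (F * F) + F * F)) : ppoint K 3 := match o with
  | Some (inl t) => affine_point B0f t
  | Some (inr (a, z)) => point_of (pz (iota a) (iota z))
  | None => point_of pe end.
have fE o o' : f o = f o' -> o = o'.
  have fval (w w' : 'cV[K]_4) (w0 : B0 *m w != 0) (w0' : B0 *m w' != 0) :
      point_of w0 = point_of w0' -> exists k, w = k *: w'.
    move/(congr1 val) => /= wE.
    have /vlineP[k] : B0 *m w \in <[B0 *m w']>%VS by rewrite -wE memv_line.
    by rewrite scalemxAr => /(frame_inj B0f) ->; exists k.
  have one0 : (1 : K) = 0 -> False by move/eqP; rewrite oner_eq0.
  case: o o' => [[t|[a z]]|] [[t'|[a' z']]|] //.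
  - by move/affine_point_inj ->.
  - by case/fval => k; rewrite col4Z => /col4_inj[_ _ _]; rewrite mulr0 => /one0.
  - by case/fval => k; rewrite col4Z => /col4_inj[_ _ _]; rewrite mulr0 => /one0.
  - case/fval => k; rewrite col4Z => /col4_inj[_ k1 _ k0].
    by move: k1; rewrite -[k]mulr1 -k0 mul0r => /one0.
  - case/fval => k; rewrite col4Z => /col4_inj[aE k1 zE _].
    by move: aE zE; rewrite -[k]mulr1 -k1 !mul1r => /(fmorph_inj iota) -> /(fmorph_inj iota) ->.
  - by case/fval => k; rewrite col4Z => /col4_inj[_]; rewrite mulr0 => /one0.
  - case/fval => k; rewrite col4Z => /col4_inj[k1 _ _ k0].
    by move: k1; rewrite -[k]mulr1 -k0 mul0r => /one0.
  - case/fval => k; rewrite col4Z => /col4_inj[k1 k0 _ _].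
    by move: k1; rewrite -[k]mulr1 -k0 mul0r => /one0.
rewrite -card_option_sum; apply: (@card_eq_II_image _ _ _ f).
- by move=> ? ? _ _; apply: fE.
- move=> [[t|[a z]]|]; rewrite inE.
  + exact: affine_point_V.
  + rewrite !inE /= => /eqP zN; apply/ratP; exists (B0 *m col4 (iota a) 1 (iota z) 0).
    split=> //.
      apply/(frame_rational _ B0f)/rational_col4.
      by rewrite !(sigma2_iota iota cardF sigmaE) !rmorph0 !rmorph1.
    rewrite hform_frame // !rmorph0 rmorph1 mulr0 mul0r !subr0 mulr1.
    by rewrite (sigma_iota iota sigmaE) -rmorphM -exprS zN rmorphN1 subrr.
  + by move=> _; apply: (frame_e0_V B0f).
- move=> P VP; have [y [y0 yr yy Py]] := proj1 (ratP P) VP.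
  have [a [b [c [d yE]]]] := frame_coords y B0f; rewrite yE in y0 yr yy Py.
  have [d0|d0] := eqVneq d 0; last first.
    have [t tA tP] := affine_pointP B0f VP Py d0 yr.
    by exists (Some (inl t)) => //; rewrite finset.in_set.
  move: yr => /(frame_rational _ B0f)/rational_col4[ar br cr _].
  move: yy; rewrite hform_frame // d0 rmorph0 mulr0 mul0r !subr0 => bc.
  have [b0|b0] := eqVneq b 0.
    move: bc; rewrite b0 mul0r add0r => /eqP.
    rewrite mulf_eq0 fmorph_eq0 orbb => /eqP c0.
    have a0 : a != 0.
      by apply: contraNneq y0 => ->; rewrite b0 c0 d0 col4_eq0 mulmx0.
    exists None; rewrite ?inE //; apply: val_inj; rewrite /= Py b0 c0 d0.
    by rewrite -(vlineZ (B0 *m e0) a0) scalemxAr col4Z !mulr0 mulr1.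
  have fixP u : sigma (sigma u) = u -> exists v, u / b = iota v.
    by move=> ur; apply: (sigma2_fixedP iota cardF sigmaE);
       rewrite !rmorphM !fmorphV ur br.
  have [a1 aE] := fixP _ ar; have [z zE] := fixP _ cr.
  exists (Some (inr (a1, z))).
    rewrite !inE /= -(inj_eq (fmorph_inj iota)) exprS rmorphM -(sigma_iota iota sigmaE).
    by rewrite -zE rmorphN1 norm_quotient.
  apply: val_inj; rewrite /= Py d0 -(vlineZ _ b0) scalemxAr col4Z -aE -zE.
  by rewrite !mulr0 mulr1 ![b * _]mulrC !divfK.
Qed.

Lemma strongly_regular_complement :
  strongly_regular G ((q ^ 3 + 1) * (q ^ 2 + 1)) (q ^ 5)
    (q * (q - 1) * (q ^ 3 + q ^ 2 - 1)) (q ^ 3 * (q ^ 2 - 1)).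
Proof.
split.
- exact: card_vertices.
- exact: card_neighbours.
- exact: card_common_neighbours_adjacent.
- exact: card_common_neighbours_nonadjacent.
Qed.

End SRG.

Theorem theorem3p6 (p e q : nat) (p_prime : prime p) (e_gt0 : (0 < e)%N)
    (q_def : q = (p ^ e)%N)
    (F : finFieldType) (cardF : #|F| = (q ^ 2)%N)
    (K : closedFieldType) (iota : {rmorphism F -> K})
    (K_algebraic : integralRange iota)
    (FJ : 'M[F]_4)
    (FJ_eq : FJ^T *m map_mx (fun x => x ^+ q) FJ = matJ F) :
  let X := fermat_surface K q in
  let V := rational_points iota X in
  let L := lines_in X in
  let O := aut_orbit X (rational_curve q (map_mx iota FJ)) in
  let G := curve_graph V O in
  [/\ generalized_quadrangle V L (@on_line K 3) (q ^ 2)%N q,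
      G = complement_graph (point_graph V L (@on_line K 3))
    & strongly_regular G
        ((q ^ 3 + 1) * (q ^ 2 + 1))%N
        (q ^ 5)%N
        (q * (q - 1) * (q ^ 3 + q ^ 2 - 1))%N
        (q ^ 3 * (q ^ 2 - 1))%N].
Proof.
have /(frobenius_rmorphism e)[sigma sigmaE] : p \in [pchar K].
  by apply: (rmorph_pchar iota); apply: (pcharF p_prime q_def cardF).
rewrite -q_def in sigmaE.
(* The equation satisfied by [FJ] is the Gram condition of a frame, transported by [iota]; this is
   the initial frame on which all constructions rest. *)
have FJf : frame sigma (map_mx iota FJ).
  split; first by apply/(rational_mapP iota cardF sigmaE); exists FJ.
  have -> : map_mx sigma (map_mx iota FJ) = map_mx iota (map_mx (fun x => x ^+ q) FJ).
    by apply/matrixP => i j; rewrite !mxE (sigma_iota iota sigmaE).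
  rewrite map_trmx -map_mxM FJ_eq; apply/matrixP => i j; rewrite !mxE.
  by case: i => [[|[|[|[|//]]]] ?]; case: j => [[|[|[|[|//]]]] ?];
    rewrite /= ?rmorphN ?rmorph1 ?rmorph0.
move=> X V L O G.
have GE : G = complement_graph (point_graph V L (@on_line K 3)).
  exact: (curve_graphE iota p_prime e_gt0 q_def cardF sigmaE FJf).
split=> //.
  exact: (fermat_quadrangle iota p_prime e_gt0 q_def cardF sigmaE FJf).
rewrite GE; exact: (strongly_regular_complement iota p_prime e_gt0 q_def cardF sigmaE FJf).
Qed.
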